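(* Let $I=[0,1]$ or $I=[0,\infty)$, let $1\le p<\infty$ be a real number and let $Y$ be a Banach r.i. space on $I$. The following assertions are equivalent: (i) $Y\in\mathcal{LI}(L^{p,1},L^{p,\infty};L^\infty)$; (ii) $Y\in\mathcal{LI}(L^{p,r},L^{p,\infty};L^\infty)$ for some $1<r<\infty$; (iii) the upper Boyd index of $Y$ satisfies $\alpha(Y)<\frac1p$.
   Context: All functions are real-valued Lebesgue measurable on $I$; $f^*$ is the nonincreasing rearrangement of $f$. A Banach r.i. (rearrangement invariant) space on $I$ is a Banach space $(X,\|\cdot\|)$ of locally integrable functions on $I$ such that: (i) $|g|\le|f|$ a.e., $f\in X$ imply $g\in X$, $\|g\|\le\|f\|$; (ii) (Fatou) $0\le f_n\uparrow$, $\sup_n\|f_n\|<\infty$ imply $f=\sup f_n\in X$ and $\|f\|=\sup_n\|f_n\|$; (iii) $X$ contains the simple integrable functions; (iv) $f\in X\iff f^*\in X$, and $\|f\|=\|f^*\|$. A quasi-Banach r.i. space is a complete quasi-normed space of measurable functions satisfying (i)-(iv) (local integrability not required). $L^{p,r}$ are the usual Lorentz spaces on $I$: $\|f\|_{p,r}=\left(\int_I (t^{1/p}f^*(t))^r\frac{dt}{t}\right)^{1/r}$ (up to a constant) for $r<\infty$, and $\|f\|_{p,\infty}=\sup_{t\in I}t^{1/p}f^*(t)$. For quasi-Banach r.i. spaces $A_0,A_1$, a couple $(X_0,X_1)$ of quasi-Banach r.i. spaces with $A_i\cap L^\infty\hookrightarrow X_i\hookrightarrow A_i+L^\infty$ (continuous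 embeddings, $i=0,1$) belongs to $\mathcal{LI}(A_0,A_1;L^\infty)$ if every linear operator $T:A_0+L^\infty\to A_1+L^\infty$ bounded from $A_0$ into $A_1$ and from $L^\infty$ into $L^\infty$ is also bounded from $X_0$ into $X_1$. For a single space $Y$, $Y\in\mathcal{LI}(A_0,A_1;L^\infty)$ means $(Y,Y)\in\mathcal{LI}(A_0,A_1;L^\infty)$ (embedding requirement included). The upper Boyd index is $\alpha(Y)=\lim_{s\to\infty}\frac{\log\|D_s\|_{Y\to Y}}{\log s}$, where, for $s>0$, $D_sf(t)=f(t/s)$ for $t\in I$ with $t/s\in I$ and $D_sf(t)=0$ otherwise (so that $\alpha(L^p)=1/p$). *)

(* Defs.v *)
From HB Require Import structures.
From mathcomp Require Import all_boot all_order all_algebra.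
From mathcomp Require Import all_classical all_reals all_analysis.
Set Implicit Arguments.
Unset Strict Implicit.
Unset Printing Implicit Defensive.
Import Order.TTheory GRing.Theory Num.Theory.
Import numFieldNormedType.Exports.
Local Open Scope classical_set_scope.
Local Open Scope ring_scope.

(** [leb R] is [R] equipped with the sigma-algebra of Lebesgue (not merely
    Borel) measurable sets; [lebm] is Lebesgue measure on it.  Functions on [I]
    are represented by functions on the whole line whose values outside [I] are
    irrelevant. *)
Notation leb R :=
  (caratheodory_type ((wlength (idfun : R -> R))^*)%mu) (only parsing).
Notation lebm := completed_lebesgue_measure.

Definition ae_on {R : realType} (I : set R) (P : R -> Prop) : Prop :=
  {ae (@lebm R), forall t, I t -> P t}.

Definition lmeasurable {R : realType} (I : set R) (f : R -> R) : Prop :=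
  measurable_fun (I : set (leb R)) (f : leb R -> R).

(** [f^*]; infinite at [t] when every level set [|f| > s] has measure [> t]. *)
Definition rearrangement {R : realType} (I : set R) (f : R -> R) (t : R)
    : \bar R :=
  ereal_inf [set s%:E | s in
    [set s : R | 0 <= s /\
      (@lebm R (I `&` [set x | (s < `|f x|)%R]) <= t%:E)%E]].

(** A space of functions on [I]: its elements (not quotiented by a.e. equality)
    and its (quasi-)norm, which is meaningful on the elements only. *)
Record fspace (R : realType) := FSpace {
  elt :> (R -> R) -> Prop;
  qnorm : (R -> R) -> R }.

Record quasi_normed_space {R : realType} (I : set R) (C : R) (X : fspace R)
    : Prop := {
  qn_measurable : forall f, X f -> lmeasurable I f;
  qn_add : forall f g, X f -> X g -> X (fun t => f t + g t);
  qn_scale : forall (a : R) f, X f -> X (fun t => a * f t);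
  qn_ge0 : forall f, X f -> 0 <= qnorm X f;
  qn_eq0 : forall f, X f -> (qnorm X f = 0 <-> ae_on I (fun t => f t = 0));
  qn_homogeneous : forall (a : R) f, X f ->
    qnorm X (fun t => a * f t) = `|a| * qnorm X f;
  qn_triangle : forall f g, X f -> X g ->
    qnorm X (fun t => f t + g t) <= C * (qnorm X f + qnorm X g) }.

Definition complete_space {R : realType} (X : fspace R) : Prop :=
  forall u : nat -> R -> R, (forall n, X (u n)) ->
  (forall e : R, 0 < e -> exists N : nat, forall m n : nat,
     (N <= m)%N -> (N <= n)%N -> qnorm X (fun t => u m t - u n t) < e) ->
  exists2 f, X f & qnorm X (fun t => u n t - f t) @[n --> \oo] --> (0 : R).

Record ri_space {R : realType} (I : set R) (X : fspace R) : Prop := {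
  ri_lattice : forall f g, X f -> lmeasurable I g ->
    ae_on I (fun t => `|g t| <= `|f t|) -> X g /\ qnorm X g <= qnorm X f;
  (* the supremum is taken in the extended reals; that it is finite a.e. is
     part of the conclusion *)
  ri_fatou : forall u : nat -> R -> R, (forall n, X (u n)) ->
    (forall n, ae_on I (fun t => 0 <= u n t /\ u n t <= u n.+1 t)) ->
    has_ubound (range (fun n => qnorm X (u n))) ->
    exists f, [/\ X f,
      ae_on I (fun t => (f t)%:E = ereal_sup (range (fun n => (u n t)%:E))) &
      qnorm X f = sup (range (fun n => qnorm X (u n)))];
  ri_simple : forall f, lmeasurable I f -> finite_set (f @` I) ->
    (@lebm R).-integrable (I : set (leb R)) (EFin \o f) -> X f;
  ri_mem : forall f, lmeasurable I f ->
    X f <-> ae_on I (fun t => rearrangement I f t \is a fin_num) /\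
            X (fun t => fine (rearrangement I f t));
  ri_norm : forall f, X f ->
    qnorm X f = qnorm X (fun t => fine (rearrangement I f t)) }.

Definition quasi_banach_ri {R : realType} (I : set R) (X : fspace R) : Prop :=
  [/\ exists C : R, quasi_normed_space I C X, complete_space X & ri_space I X].

(** [locally_integrable] of the library only makes sense on open sets. *)
Definition banach_ri {R : realType} (I : set R) (X : fspace R) : Prop :=
  [/\ quasi_normed_space I 1 X, complete_space X, ri_space I X &
      forall f, X f -> forall K : set R, compact K -> K `<=` I ->
        (@lebm R).-integrable (K : set (leb R)) (EFin \o f)].

Definition lorentz_norm {R : realType} (I : set R) (p : R) (r : \bar R)
    (f : R -> R) : \bar R :=
  match r with
  | r%:E =>
      ((\int[@lebm R]_(t in (I : set (leb R)))
         (((((t : R) `^ p^-1)%:E * rearrangement I f t) `^ r)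
          * ((t : R)^-1)%:E)) `^ r^-1)%E
  | +oo%E => ereal_sup [set ((t `^ p^-1)%:E * rearrangement I f t)%E | t in I]
  | -oo%E => 0%E
  end.

Definition lorentz {R : realType} (I : set R) (p : R) (r : \bar R) : fspace R :=
  FSpace [set f | lmeasurable I f /\ (lorentz_norm I p r f < +oo)%E]
         (fun f => fine (lorentz_norm I p r f)).

Definition Linfty_norm {R : realType} (I : set R) (f : R -> R) : \bar R :=
  Lnorm (@lebm R) +oo%E ((EFin \o f : leb R -> \bar R) \_ (I : set (leb R))).

Definition Linfty {R : realType} (I : set R) : fspace R :=
  FSpace [set f | lmeasurable I f /\ (Linfty_norm I f < +oo)%E]
         (fun f => fine (Linfty_norm I f)).

Definition cap_space {R : realType} (A B : fspace R) : fspace R :=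
  FSpace [set f | A f /\ B f] (fun f => Num.max (qnorm A f) (qnorm B f)).

Definition decomposes {R : realType} (I : set R) (A B : fspace R)
    (f a b : R -> R) : Prop :=
  [/\ A a, B b & ae_on I (fun t => f t = a t + b t)].

Definition sum_space {R : realType} (I : set R) (A B : fspace R) : fspace R :=
  FSpace [set f | lmeasurable I f /\ exists a b, decomposes I A B f a b]
         (fun f => inf [set c : R | exists a b,
            decomposes I A B f a b /\ c = qnorm A a + qnorm B b]).

Definition embeds {R : realType} (X Z : fspace R) : Prop :=
  elt X `<=` elt Z /\ exists C : R, forall f, X f -> qnorm Z f <= C * qnorm X f.

(** Elements are functions and not classes, so an operator between spaces of classes modulo a.e.
    equality is a map on functions that respects a.e. equality and is linear
    modulo it. *)
Record linear_operator {R : realType} (I : set R) (X Z : fspace R)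
    (T : (R -> R) -> (R -> R)) : Prop := {
  lo_mem : forall f, X f -> Z (T f);
  lo_ae : forall f g, X f -> X g ->
    ae_on I (fun t => f t = g t) -> ae_on I (fun t => T f t = T g t);
  lo_linear : forall (a : R) f g, X f -> X g ->
    ae_on I (fun t => T (fun s => a * f s + g s) t = a * T f t + T g t) }.

Definition bounded_operator {R : realType} (X Z : fspace R)
    (T : (R -> R) -> (R -> R)) : Prop :=
  exists C : R, forall f, X f -> Z (T f) /\ qnorm Z (T f) <= C * qnorm X f.

Record LI_couple {R : realType} (I : set R) (A0 A1 X0 X1 : fspace R)
    : Prop := {
  LI_ri0 : quasi_banach_ri I X0;
  LI_ri1 : quasi_banach_ri I X1;
  LI_low0 : embeds (cap_space A0 (Linfty I)) X0;
  LI_up0 : embeds X0 (sum_space I A0 (Linfty I));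
  LI_low1 : embeds (cap_space A1 (Linfty I)) X1;
  LI_up1 : embeds X1 (sum_space I A1 (Linfty I));
  LI_interp : forall T,
    linear_operator I (sum_space I A0 (Linfty I)) (sum_space I A1 (Linfty I)) T ->
    bounded_operator A0 A1 T -> bounded_operator (Linfty I) (Linfty I) T ->
    bounded_operator X0 X1 T }.

Definition LI {R : realType} (I : set R) (A0 A1 Y : fspace R) : Prop :=
  LI_couple I A0 A1 Y Y.

Definition dilation {R : realType} (I : set R) (s : R) (f : R -> R) : R -> R :=
  fun t => if `[< I t /\ I (t / s) >] then f (t / s) else 0.

(** Real supremum: on a Banach r.i. space [Y], dilations map [Y] to itself and
    their norms on the unit ball are bounded (by [max 1 s]). *)
Definition operator_norm {R : realType} (Y : fspace R)
    (T : (R -> R) -> (R -> R)) : R :=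
  sup [set qnorm Y (T f) | f in [set f | Y f /\ qnorm Y f <= 1]].

Definition upper_boyd_index {R : realType} (I : set R) (Y : fspace R) : R :=
  lim (ln (operator_norm Y (dilation I s)) / ln s @[s --> +oo]).

(* Main.v *)
(** Write a = 1/p and let h(s) be the norm of the dilation D_s on Y, so that the
    upper Boyd index is inf_(s > 1) (ln h(s) / ln s) by Fekete's lemma.  We show
    that, for every r >= 1, Y is in LI(L^(p,r), L^(p,oo); L^oo) if and only if
    this index is smaller than a.

    If h(s) <= C s^b with b < a, the maximal function
    sum_k 2^(-ka) f^*(2^(-k-1) t) is bounded on Y.  It dominates (Tf)^* for every
    admissible T: cut f at the level f^*(t), use L^(p,r) -> L^(p,oo) on the top
    part and L^oo -> L^oo on the rest.

    Conversely, put A f(t) = f(2^(-p) t) / 2, which is contractive on L^(p,oo),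
    and S_L = sum_(k < L) A^k.  Truncation and Chebyshev's inequality give
    S_L : L^(p,r) -> L^(p,oo) with norm O(L^(1 - d)) up to a logarithm, for
    d = 1/(r + p).  Operators with integral kernels would not do here: for p = 1
    and r > 1 the space L^(1,r) is not locally integrable.  A superposition T of
    the S_(2^n) is therefore admissible, so S_L has norm O(L^(1 - d')) on Y for
    some d' > 0.  As the coefficient of A^(L-1) in (S_L)^N is of order L^(N-1),
    taking N d' > 1 yields a power of A of norm less than 1, that is, some
    s > 1 with h(s) < s^a. *)
Require Import Defs.
From HB Require Import structures.
From mathcomp Require Import all_boot all_order all_algebra.
From mathcomp Require Import all_classical all_reals all_analysis.
From mathcomp Require Import measurable_realfun ess_sup_inf.
From mathcomp Require Import lra ring zify.
Set Implicit Arguments.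
Unset Strict Implicit.
Unset Printing Implicit Defensive.
Import Order.TTheory GRing.Theory Num.Theory.
Import numFieldNormedType.Exports.
Local Open Scope classical_set_scope.
Local Open Scope ring_scope.

(** * Dilation invariance of Lebesgue measure *)

(** Rearrangement invariance only compares functions through their rearrangements, and on [0, 1]
    there may be no room for disjoint copies of a function. Dilations close to 1 are therefore
    bounded by splitting a stretched f^* along a set which, like its complement, fills at most 15/16
    of every interval [0, z[; larger dilations follow by composition. In the converse, contractivity
    of A gives no saving over the order L for S_L. Any saving L^(-d') is enough: N iterations save
    L^(-N d'), whereas the coefficient of A^(L-1) falls only one power short of L^N. The ratio 2^p
    makes A critical: for s = 2^(p m) one has s^a = 2^m, so a power of A of norm below 1 is exactly
    a value of h below the critical one. The saving comes from the gap between L^(p,r) and L^(p,oo):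
    on L terms, an l^r bound beats the naive count in l^p sums. The series defining T may diverge at
    some points; the same level-set estimates give absolute convergence almost everywhere, which is
    why T is built pointwise along the orbits t / 2^(p k). *)

Section lebesgue_scaling.
Context {R : realType}.
Implicit Types (c : R) (A X : set R).

Local Notation outer := ((wlength (idfun : R -> R))^*)%mu.

Lemma lebmE A : lebm A = outer A. Proof. by []. Qed.

Let outer_scale_le c X : 0 < c ->
  (outer [set t | X (t / c)%R] <= c%:E * outer X)%E.
Proof.
move=> c0; rewrite -lee_pdivrMl//.
apply: le_ereal_inf_tmp => _ [A [mA XA] <-].
rewrite lee_pdivrMl//.
have /choice[ab abE] : forall k, exists ab : R * R, A k = `]ab.1, ab.2]%classic.
  by move=> k; have [ab _ <-] := mA k; exists ab.
pose J k : set (ocitv_type R) := `](c * (ab k).1), (c * (ab k).2)]%classic.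
have len k : (wlength (idfun : R -> R) (J k) = c%:E * wlength (idfun : R -> R) (A k))%E.
  rewrite /J abE !wlength_itv/= !lte_fin ltr_pM2l//; case: ifPn => _; last by rewrite mule0.
  by rewrite -!EFinB -EFinM mulrBr.
apply: (@le_trans _ _ (\sum_(0 <= k <oo) wlength (idfun : R -> R) (J k))%E).
  apply: ereal_inf_lbound; exists J => //.
  split=> [k|t /= /XA[k _]]; first by exists ((c * (ab k).1), (c * (ab k).2)).
  rewrite abE/= => tk; exists k => //=; move: tk; rewrite !in_itv/=.
  by rewrite ltr_pdivlMr// ler_pdivrMr// ![_ * c]mulrC.
under eq_eseriesr do rewrite len.
by rewrite nneseriesZl ?lee_fin ?(ltW c0)// => i _; exact: wlength_ge0.
Qed.

Let outer_scale c X : 0 < c -> outer [set t | X (t / c)] = (c%:E * outer X)%E.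
Proof.
move=> c0; apply/eqP; rewrite eq_le outer_scale_le//=.
have := @outer_scale_le c^-1 [set t | X (t / c)].
rewrite invr_gt0 => /(_ c0).
rewrite (_ : [set t | _ (t / c^-1)] = X); last first.
  by apply/seteqP; split=> t /=; rewrite invrK mulfK// gt_eqF.
by rewrite lee_pdivlMl.
Qed.

Lemma lebm_scale c X : 0 < c -> (lebm [set t | X (t / c)%R] = c%:E * lebm X)%E.
Proof. exact: outer_scale. Qed.

(** Carathéodory's criterion is transported by scaling the test set, which covers all Lebesgue
    measurable sets and not only the Borel ones. *)
Lemma measurable_scale c (X : set (leb R)) : 0 < c -> measurable X ->
  measurable ([set t | X (t / c)] : set (leb R)).
Proof.
move=> c0 mX; have {}mX : outer.-caratheodory X by [].
suff : outer.-caratheodory [set t | X (t / c)] by [].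
move=> Z.
have sc Y : outer Y = (c%:E * outer [set t | Y (t * c)%R])%E.
  rewrite -(@outer_scale c)//; congr outer; apply/seteqP.
  by split=> t /=; rewrite divfK// gt_eqF.
rewrite sc (mX [set t | Z (t * c)]) ge0_muleDr ?outer_measure_ge0// .
rewrite [in RHS]sc [X in _ = (_ + X)%E]sc; congr (_ * outer _ + _ * outer _)%E;
  by apply/seteqP; split=> t /=; rewrite mulfK// gt_eqF.
Qed.

Lemma borel_lebesgue_measurable (A : set (measurableTypeR R)) : measurable A ->
  measurable (A : set (leb R)).
Proof. by move=> mA; exact: sub_caratheodory. Qed.

Lemma leb_measurable_itv (i : interval R) : measurable ([set` i] : set (leb R)).
Proof. by apply: borel_lebesgue_measurable; exact: measurable_itv. Qed.

Lemma lebm_itv (i : interval R) :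
  lebm [set` i] = (if i.2 > i.1 then (i.2 : \bar R) - i.1 else 0)%E.
Proof. exact: lebesgue_measure_itv. Qed.

Lemma borel_fun_lebesgue (D : set (measurableTypeR R)) (f : R -> R) :
  measurable_fun D (f : measurableTypeR R -> R) ->
  measurable D -> measurable_fun (D : set (leb R)) (f : leb R -> R).
Proof. by move=> mf mD _ B mB; apply: borel_lebesgue_measurable; exact: mf. Qed.

End lebesgue_scaling.

(** * Rearrangements *)

Section rearrangement_lemmas.
Context {R : realType} (I : set R).
Implicit Types (f g : R -> R) (t y : R) (A B : set R).

Definition distr f y : \bar R := lebm (I `&` [set x | y < `|f x|]).

Lemma le_lebm A B : A `<=` B -> (lebm A <= lebm B)%E.
Proof. by move=> AB; rewrite !lebmE; exact: le_mu_ext. Qed.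

Lemma lebm_ge0 A : (0 <= lebm A)%E.
Proof. by rewrite lebmE; exact: outer_measure_ge0. Qed.

Lemma distr_nonincr f y1 y2 : y1 <= y2 -> (distr f y2 <= distr f y1)%E.
Proof. by move=> y12; apply: le_lebm => x /= [Ix /(le_lt_trans y12)]. Qed.

Lemma rearr_le f t y : 0 <= y -> (distr f y <= t%:E)%E ->
  (rearrangement I f t <= y%:E)%E.
Proof. by move=> y0 ft; apply: ereal_inf_lbound; exists y. Qed.

Lemma rearr_lt f t y : (rearrangement I f t < y%:E)%E -> (distr f y <= t%:E)%E.
Proof.
move=> /ereal_inf_lt[_ [s [s0 fs] <-]]; rewrite lte_fin => sy.
by rewrite (le_trans _ fs)//; apply: distr_nonincr; exact: ltW.
Qed.

Lemma rearr_ge f t y : (t%:E < distr f y)%E -> (y%:E <= rearrangement I f t)%E.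
Proof.
move=> tf; rewrite leNgt; apply: contraTN tf => /rearr_lt; by rewrite leNgt.
Qed.

Lemma rearr_ge0 f t : (0 <= rearrangement I f t)%E.
Proof. by apply: le_ereal_inf_tmp => _ [s [s0 _] <-]; rewrite lee_fin. Qed.

Lemma rearr_nonincr f s t : s <= t ->
  (rearrangement I f t <= rearrangement I f s)%E.
Proof.
move=> st; apply: ereal_inf_le_tmp => _ [y [y0 fy] <-]; exists y => //; split => //.
by rewrite (le_trans fy)// lee_fin.
Qed.

Lemma rearr_distr_le f g s t :
  (forall y, 0 <= y -> (distr f y <= s%:E)%E -> (distr g y <= t%:E)%E) ->
  (rearrangement I g t <= rearrangement I f s)%E.
Proof.
move=> fg; apply: ereal_inf_le_tmp => _ [y [y0 fy] <-]; exists y => //; split => //.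
exact: fg.
Qed.

Lemma measurable_rearr f (D : set (leb R)) : measurable D ->
  measurable_fun D (rearrangement I f).
Proof.
move=> mD; apply: (measurability (@ErealGenOInfty.G R)).
  exact: ErealGenOInfty.measurableE.
move=> _ [_ [x ->] <-]; apply: measurableI => //.
apply: borel_lebesgue_measurable; apply: is_interval_measurable.
move=> s t /=; rewrite !in_itv/= !andbT => xs xt z /andP[sz zt].
by rewrite in_itv/= andbT (lt_le_trans xt)// rearr_nonincr.
Qed.

Lemma lmeasurable_rearr f : measurable (I : set (leb R)) ->
  lmeasurable I (fun t => fine (rearrangement I f t)).
Proof.
move=> mI; apply: measurableT_comp; first exact: fine_measurable.
exact: measurable_rearr.
Qed.

Lemma lmeasurable_lt f y : measurable (I : set (leb R)) -> lmeasurable I f ->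
  measurable (I `&` [set x | y < `|f x|] : set (leb R)).
Proof.
move=> mI mf.
have mnf : measurable_fun (I : set (leb R)) (fun x : leb R => `|f x|).
  exact: measurableT_comp.
have := mnf mI `]y, +oo[%classic (measurable_itv _).
by congr (measurable (_ `&` _)); apply/seteqP; split=> x /=; rewrite in_itv/= andbT.
Qed.

(** The infimum defining the rearrangement is attained: the sets where |f| > y + 1/(n+1) have
    measure at most t and increase to the set where |f| > y. *)
Lemma distr_rearr f t y : measurable (I : set (leb R)) -> lmeasurable I f ->
  (rearrangement I f t <= y%:E)%E -> (distr f y <= t%:E)%E.
Proof.
move=> mI mf fty; pose F n : set (leb R) := I `&` [set x | y + n.+1%:R^-1 < `|f x|].
have FE : \bigcup_n F n = I `&` [set x | y < `|f x|].
  apply/seteqP; split=> x.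
    by case=> n _ [Ix /= h]; split=> //=; rewrite (le_lt_trans _ h)// lerDl.
  move=> [Ix /=]; rewrite -subr_gt0 => fx0.
  have /ltr_add_invr[n] := fx0; rewrite add0r => nfx.
  by exists n => //; split => //=; rewrite addrC -ltrBrDr.
have mF n : measurable (F n) by exact: lmeasurable_lt.
have cF : lebm (F n) @[n --> \oo] --> distr f y.
  rewrite /distr -FE; apply: nondecreasing_cvg_mu => //.
    exact: bigcupT_measurable.
  move=> m n mn; apply/subsetPset => x [Ix /= h]; split => //=.
  rewrite (le_lt_trans _ h)// lerD2l lef_pV2 ?posrE// ler_nat ltnS//.
rewrite -(cvg_lim _ cF)//; apply: lime_le; first by apply/cvg_ex; exists (distr f y).
apply: nearW => n; apply: rearr_lt; rewrite (le_lt_trans fty)// lte_fin ltrDl//.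
Qed.

End rearrangement_lemmas.

(** * Almost everywhere statements on I *)

Section almost_everywhere_on.
Context {R : realType} (I : set R).
Implicit Types (P Q : R -> Prop) (A B : set R).

Lemma lebmU_le A B : (lebm (A `|` B) <= lebm A + lebm B)%E.
Proof. by rewrite !lebmE; exact: outer_measureU2. Qed.

Lemma lebm_le0 A : (lebm A <= 0)%E -> lebm A = 0.
Proof. by move=> A0; apply/eqP; rewrite eq_le A0 lebm_ge0. Qed.

(** Outer measure zero is the working form of [ae_on], so that no exceptional set has to be shown
    measurable. *)
Lemma ae_onE P : ae_on I P <-> lebm (I `&` [set t | ~ P t]) = 0.
Proof.
have IE : ~` [set t | I t -> P t] = I `&` [set t | ~ P t].
  by apply/seteqP; split=> t /=; rewrite not_implyE.
split=> [[A [mA A0 IA]]|/negligible_outer_measure[A [mA A0 IA]]].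
  apply/eqP; rewrite eq_le lebm_ge0 andbT -A0.
  by apply: le_lebm; rewrite -IE.
by exists A; split; [exact: borel_lebesgue_measurable|exact: A0|rewrite IE].
Qed.

Lemma ae_on_all P : (forall t, I t -> P t) -> ae_on I P.
Proof. by move=> IP; exact: aeW. Qed.

Lemma ae_on_sub P Q : ae_on I P -> (forall t, I t -> P t -> Q t) -> ae_on I Q.
Proof.
move=> /ae_onE IP PQ; apply/ae_onE; apply: lebm_le0; rewrite -IP.
by apply: le_lebm => t /= [It Qt]; split=> // Pt; apply: Qt; exact: PQ.
Qed.

Lemma ae_on_sub2 P1 P2 Q : ae_on I P1 -> ae_on I P2 ->
  (forall t, I t -> P1 t -> P2 t -> Q t) -> ae_on I Q.
Proof.
move=> /ae_onE IP1 /ae_onE IP2 PQ; apply/ae_onE; apply: lebm_le0.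
rewrite -[leRHS]add0e -[X in (X + _)%E]IP1 -IP2.
apply: le_trans (lebmU_le _ _); apply: le_lebm => t /= [It Qt].
have [P1t|P1t] := pselect (P1 t); last by left.
by right; split=> // P2t; apply: Qt; exact: PQ.
Qed.

Lemma ae_on_forall (P : nat -> R -> Prop) : (forall n, ae_on I (P n)) ->
  ae_on I (fun t => forall n, P n t).
Proof.
move=> IP; have := ae_foralln IP; apply: filterS => t h It n; exact: h.
Qed.

Lemma distr_ae_le f g y : ae_on I (fun t => `|g t| <= `|f t|) ->
  (distr I g y <= distr I f y)%E.
Proof.
move=> /ae_onE gf; rewrite -[leRHS]adde0 -gf; apply: le_trans (lebmU_le _ _).
apply: le_lebm => t /= [It ygt].
have [gft|gft] := leP `|g t| `|f t|; [left|right]; split => //=.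
  exact: lt_le_trans gft.
Qed.

End almost_everywhere_on.

Section unit_or_half_line.
Context {R : realType} (I : set R).
Hypothesis hI : I = `[0, 1]%classic \/ I = `[0, +oo[%classic.

Lemma I_measurable : measurable (I : set (leb R)).
Proof. by case: hI => ->; exact: leb_measurable_itv. Qed.

Lemma I_ge0 t : I t -> 0 <= t.
Proof. by case: hI => -> /=; rewrite in_itv/= ?andbT// => /andP[]. Qed.

Lemma I_le s t : I t -> 0 <= s -> s <= t -> I s.
Proof.
case: hI => -> /=; rewrite !in_itv/= ?andbT// => /andP[_ t1] -> st /=.
exact: le_trans t1.
Qed.

Lemma I1 : I 1.
Proof. by case: hI => -> /=; rewrite in_itv/= ?lexx ler01. Qed.

Lemma I_div s t : 1 <= s -> I t -> I (t / s).
Proof.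
move=> s1 It; have s0 : 0 < s by apply: lt_le_trans s1.
have t0 := I_ge0 It; apply: (I_le It); first by rewrite divr_ge0// ltW.
by rewrite ler_pdivrMr// ler_peMr.
Qed.

Lemma ae_on_gt0 : ae_on I (fun t => 0 < t).
Proof.
apply/ae_onE; apply: lebm_le0.
have <- : lebm (`[0, 0] : set R) = 0 by rewrite lebm_itv/= ltxx.
apply: le_lebm => t /= [/I_ge0 t0 /negP]; rewrite -leNgt in_itv/= => ->.
by rewrite t0.
Qed.

Lemma ae_on_div s (P : R -> Prop) : 1 <= s -> ae_on I P ->
  ae_on I (fun t => P (t / s)).
Proof.
move=> s1 /ae_onE IP; apply/ae_onE; apply: lebm_le0.
have s0 : 0 < s by apply: lt_le_trans s1.
have := @lebm_scale R s (I `&` [set t | ~ P t]) s0; rewrite IP mule0 => <-.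
by apply: le_lebm => t /= [It Pt]; split=> //; exact: I_div.
Qed.

Lemma lmeasurable_div s f : 1 <= s -> lmeasurable I f ->
  lmeasurable I (fun t => f (t / s)).
Proof.
move=> s1 mf mI B mB; have s0 : 0 < s by apply: lt_le_trans s1.
have := measurable_scale s0 (mf mI B mB).
have := I_measurable => /measurableI /[apply].
congr measurable; apply/seteqP; split=> t /= [It]; first by move=> [].
by move=> Bt; split=> //; split=> //; exact: I_div.
Qed.

Lemma distr_div s f y : 1 <= s ->
  (distr I (fun t => f (t / s)%R) y <= s%:E * distr I f y)%E.
Proof.
move=> s1; have s0 : 0 < s by apply: lt_le_trans s1.
rewrite /distr -lebm_scale//; apply: le_lebm => t /= [It h]; split=> //.
exact: I_div.
Qed.

Lemma lmeasurable_cst (c : R) : lmeasurable I (fun=> c).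
Proof. exact: measurable_cst. Qed.

Lemma lmeasurableD f g : lmeasurable I f -> lmeasurable I g ->
  lmeasurable I (fun t => f t + g t).
Proof. exact: measurable_funD. Qed.

Lemma lmeasurableZ (c : R) f : lmeasurable I f -> lmeasurable I (fun t => c * f t).
Proof. by move=> mf; apply: measurable_funM => //; exact: measurable_cst. Qed.

Lemma lmeasurable_norm f : lmeasurable I f -> lmeasurable I (fun t => `|f t|).
Proof. by move=> mf; apply: measurableT_comp mf. Qed.

(** Rests on the completeness of Lebesgue measure on the Carathéodory sigma-algebra. *)
Lemma lmeasurable_ae f g : ae_on I (fun t => f t = g t) -> lmeasurable I f ->
  lmeasurable I g.
Proof.
move=> fg mf.
have /(ae_measurable_fun completed_lebesgue_measure_is_complete) h :
  ae_eq (@lebm R) (I : set (leb R)) (EFin \o f : leb R -> \bar R) (EFin \o g : leb R -> \bar R).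
  suff: ae_on I (fun t => (f t)%:E = (g t)%:E) by [].
  by apply: ae_on_sub fg _ => t It ->.
apply/measurable_EFinP; apply: h; exact/measurable_EFinP.
Qed.

Lemma lmeasurable_indic (B : set (leb R)) f : measurable B -> lmeasurable I f ->
  lmeasurable I (fun t => f t * \1_B t).
Proof.
move=> mB mf; apply: measurable_funM => //; exact: measurable_indic.
Qed.

End unit_or_half_line.

Section dyadic_set.
Context {R : realType}.

(* Both this set and its complement occupy a fixed proportion of every interval [0, z[ *)
Definition fours : set (leb R) := \bigcup_(k : int) `[(4 : R) ^ k, 2 * 4 ^ k[%classic.

Lemma measurable_fours : measurable fours.
Proof. by apply: countable_bigcupT_measurable => // k; exact: leb_measurable_itv. Qed.

Lemma exists_exprz4 (z : R) : 0 < z -> exists k : int, 4 ^ k <= z < 4 ^ (k + 1).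
Proof.
move=> z0.
have l40 : 0 < ln (4 : R) by rewrite ln_gt0// ltr1n.
have E (k : int) : 4 ^ k = expR (k%:~R * ln 4) :> R.
  by case: k => n; rewrite -?exprnP ?exprnN ?NegzE -?exprnN ?mulNr ?expRN ?intrN ?mulNr ?expRN expRM_natl lnK ?posrE.
exists (Num.floor (ln z / ln 4)); rewrite !E -[z in _ <= z]lnK// -[z in z < _]lnK//.
rewrite ler_expR ltr_expR -ler_pdivlMr// -ltr_pdivrMr//.
by rewrite ge_floor/= floorD1_gt.
Qed.

Let lebm_interval_missing (A : set R) (a b z : R) : 0 <= a -> a <= b -> b <= z ->
  A `&` `[a, b[ = set0 -> (lebm (A `&` `[0%R, z[) <= (z - (b - a))%R%:E)%E.
Proof.
move=> a0 ab bz AB.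
apply: (@le_trans _ _ (lebm (`[0%R, a[ `|` `[b, z[ : set R))).
  apply: le_lebm => t /= [At]; rewrite !in_itv/= => /andP[t0 tz].
  have [ta|at_] := ltP t a; first by left; rewrite t0.
  right; rewrite tz andbT leNgt; apply/negP => tb.
  suff : (A `&` `[a, b[) t by rewrite AB.
  by split => //=; rewrite in_itv/= at_.
apply: (le_trans (lebmU_le _ _)); rewrite !lebm_itv/= !lte_fin.
by do 2 case: ltP => ?; rewrite ?adde0 ?add0e ?oppr0 -?EFinD ?lee_fin; lra.
Qed.

(** Let 4^k <= z < 4^(k+1) and w = 4^(k-1). Then [w, 2w[ lies in [fours] and [2w, 4w[ outside it,
    both below z. Each of the two sets thus misses a length of at least w > z / 16. *)
Lemma lebm_fours_le (z : R) : 0 < z ->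
  (lebm (fours `&` `[0%R, z[) <= (15 / 16 * z)%R%:E)%E /\
  (lebm (~` fours `&` `[0%R, z[) <= (15 / 16 * z)%R%:E)%E.
Proof.
move=> /exists_exprz4[k /andP[kz zk]].
have p4 (j : int) : 0 < (4 : R) ^ j by rewrite exprz_gt0.
have S (j : int) : (4 : R) ^ (j + 1) = 4 * 4 ^ j by rewrite exprzDr ?unitfE// expr1z mulrC.
have mono (i j : int) : i <= j -> (4 : R) ^ i <= 4 ^ j by apply: ler_weXz2l; rewrite ler1n.
have := S (k - 1); rewrite subrK => Sk.
have := p4 (k - 1); set w := 4 ^ (k - 1) in Sk * => w0.
rewrite S Sk in zk; rewrite Sk in kz.
split.
  apply: (@le_trans _ _ (z - (4 * w - 2 * w))%:E); last by rewrite lee_fin; lra.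
  apply: lebm_interval_missing; [lra|lra|lra|].
  apply/seteqP; split=> // t [[j _ /=]]; rewrite !in_itv/= => /andP[jt tj] /andP[wt tw].
  have [kj|kj] := lerP k j.
    by have := mono _ _ kj; rewrite Sk; lra.
  have /mono : j <= k - 1 by lia.
  by rewrite -/w; lra.
apply: (@le_trans _ _ (z - (2 * w - w))%:E); last by rewrite lee_fin; lra.
apply: lebm_interval_missing; [lra|lra|lra|].
apply/seteqP; split=> // t [/= nf wt]; apply: nf; exists (k - 1) => //.
Qed.

End dyadic_set.

(** * Dilations on rearrangement invariant spaces *)

Lemma bernoulli_ineq (R : realDomainType) (x : R) n : 0 <= x ->
  1 + n%:R * x <= (1 + x) ^+ n.
Proof.
move=> x0; elim: n => [|n IH]; first by rewrite mul0r addr0 expr0.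
rewrite exprSr; apply: (@le_trans _ _ ((1 + n%:R * x) * (1 + x))); last first.
  by rewrite ler_wpM2r// addr_ge0.
rewrite -natr1; have : 0 <= n%:R * x * x by rewrite !mulr_ge0.
lra.
Qed.

Lemma exprn_unbounded (R : archiRealFieldType) (b S : R) : 1 < b ->
  exists n, S <= b ^+ n.
Proof.
move=> b1; have b0 : 0 < b - 1 by lra.
have S0 := normr_ge0 (S / (b - 1)).
exists (Num.bound `|S / (b - 1)|); have := @bernoulli_ineq _ (b - 1) (Num.bound `|S / (b - 1)|).
rewrite subrKC => /(_ (ltW b0)); apply: le_trans.
have := le_trans (ler_norm _) (ltW (archi_boundP S0)).
rewrite ler_pdivrMr//; lra.
Qed.

Section rearrangement_invariant_space.
Context {R : realType} (I : set R).
Hypothesis hI : I = `[0, 1]%classic \/ I = `[0, +oo[%classic.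
Context (Y : fspace R) (hY : banach_ri I Y).
Implicit Types (f g : R -> R).

Local Notation "'N'" := (qnorm Y).

Let mI := I_measurable hI.

Lemma Y_measurable f : Y f -> lmeasurable I f.
Proof. by have [+ _ _ _] := hY; move=> /qn_measurable; exact. Qed.

Lemma Y_add f g : Y f -> Y g -> Y (fun t => f t + g t).
Proof. by have [+ _ _ _] := hY; move=> /qn_add; exact. Qed.

Lemma Y_scale a f : Y f -> Y (fun t => a * f t).
Proof. by have [+ _ _ _] := hY; move=> /qn_scale; exact. Qed.

Lemma Y_norm_ge0 f : Y f -> 0 <= N f.
Proof. by have [+ _ _ _] := hY; move=> /qn_ge0; exact. Qed.

Lemma Y_normZ a f : Y f -> N (fun t => a * f t) = `|a| * N f.
Proof. by have [+ _ _ _] := hY; move=> /qn_homogeneous; exact. Qed.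

Lemma Y_normD f g : Y f -> Y g -> N (fun t => f t + g t) <= N f + N g.
Proof. by have [+ _ _ _] := hY; move=> /qn_triangle h Yf Yg; rewrite -[leRHS]mul1r h. Qed.

Lemma Y_lattice f g : Y f -> lmeasurable I g ->
  ae_on I (fun t => `|g t| <= `|f t|) -> Y g /\ N g <= N f.
Proof. by have [_ _ + _] := hY; move=> /ri_lattice; exact. Qed.

Lemma Y_ae_eq f g : Y f -> ae_on I (fun t => f t = g t) -> Y g /\ N g = N f.
Proof.
move=> Yf fg; have mg := lmeasurable_ae fg (Y_measurable Yf).
have [|Yg gf] := Y_lattice Yf mg; first by apply: ae_on_sub fg _ => t _ ->.
split => //; apply/eqP; rewrite eq_le gf/=.
have [|//] := Y_lattice Yg (Y_measurable Yf).
by apply: ae_on_sub fg _ => t _ ->.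
Qed.

Lemma Y_abs f : Y f -> Y (fun t => `|f t|) /\ N (fun t => `|f t|) = N f.
Proof.
move=> Yf; have mf := Y_measurable Yf.
have [|Ya af] := Y_lattice Yf (lmeasurable_norm mf).
  by apply: ae_on_all => t _; rewrite normr_id.
split => //; apply/eqP; rewrite eq_le af/=.
have [|//] := Y_lattice Ya mf.
by apply: ae_on_all => t _; rewrite normr_id.
Qed.

Lemma Y_norm0 f : Y f -> N f = 0 <-> ae_on I (fun t => f t = 0).
Proof. by have [+ _ _ _] := hY; move=> /qn_eq0; exact. Qed.

Definition rearr f t : R := fine (rearrangement I f t).

Lemma rearr_ge0r f t : 0 <= rearr f t.
Proof. by rewrite /rearr fine_ge0// rearr_ge0. Qed.

Lemma Y_rearr f : Y f -> Y (rearr f) /\ N (rearr f) = N f.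
Proof.
move=> Yf; have [_ _ + _] := hY => rY; split; last by rewrite [RHS](ri_norm rY Yf).
by have [+ _] := ri_mem rY (Y_measurable Yf) => /(_ Yf)[].
Qed.

(** An infinite value at t would, by monotonicity, persist on ]0, min(t, 1)[, a set of positive
    measure. *)
Lemma rearr_fin_num f t : Y f -> 0 < t -> rearrangement I f t \is a fin_num.
Proof.
move=> Yf t0; have [_ _ rY _] := hY.
have [+ _] := ri_mem rY (Y_measurable Yf) => /(_ Yf)[/ae_onE fin _].
rewrite ge0_fin_numE ?rearr_ge0// ltey; apply/negP => /eqP foo.
pose s := Num.min t 1; have s0 : 0 < s by rewrite lt_min t0/=.
have : (lebm (`]0%R, s[ : set R) <= 0)%E.
  rewrite -fin; apply: le_lebm => x /=; rewrite in_itv/= lt_min => /and3P[x0 xt x1].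
  split; first by apply: (I_le hI (I1 hI)); exact: ltW.
  have := rearr_nonincr I f (ltW xt); rewrite foo leye_eq => /eqP ->.
  by [].
by rewrite lebm_itv/= lte_fin s0 oppr0 adde0 lee_fin leNgt s0.
Qed.

Lemma rearrE f t : Y f -> 0 < t -> (rearr f t)%:E = rearrangement I f t.
Proof. by move=> Yf t0; rewrite /rearr fineK// rearr_fin_num. Qed.

Lemma rearr_noninc f s t : Y f -> 0 < s -> s <= t -> rearr f t <= rearr f s.
Proof.
move=> Yf s0 st; rewrite -lee_fin !rearrE//; last exact: lt_le_trans st.
exact: rearr_nonincr.
Qed.

(** The function [f] may be far from nonincreasing: it bounds g^* pointwise, so the lattice property
    puts g^* in Y, and invariance carries this back to g. *)
Lemma Y_rearr_le f g : Y f -> lmeasurable I g ->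
  ae_on I (fun t => rearrangement I g t <= (f t)%:E)%E -> Y g /\ N g <= N f.
Proof.
move=> Yf mg gf; have [_ _ rY _] := hY.
have [||Yg Ng] := @Y_lattice f (rearr g) Yf.
- exact: lmeasurable_rearr.
- apply: ae_on_sub gf _ => t _ gft; rewrite ger0_norm ?rearr_ge0r//.
  apply: le_trans (ler_norm _).
  rewrite -lee_fin /rearr fineK// ge0_fin_numE ?rearr_ge0//.
  by apply: le_lt_trans gft _; rewrite ltry.
have [_ Yg'] := ri_mem rY mg.
have {}Yg' : Y g.
  apply: Yg'; split; last exact: Yg.
  apply: ae_on_sub gf _ => t _ gft; rewrite ge0_fin_numE ?rearr_ge0//.
  by apply: le_lt_trans gft _; rewrite ltry.
by split => //; rewrite (ri_norm rY Yg').
Qed.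

Lemma Y_dominated f g : Y f -> lmeasurable I g ->
  (forall t, 0 < t -> (rearrangement I g t <= rearrangement I f t)%E) ->
  Y g /\ N g <= N f.
Proof.
move=> Yf mg gf; have [Yr <-] := Y_rearr Yf.
apply: Y_rearr_le => //; apply: ae_on_sub (ae_on_gt0 hI) _ => t _ t0.
by rewrite rearrE// gf.
Qed.

(* [g^*] is split along [fours] into two functions whose rearrangements are at most [f^*] *)
Lemma Y_two_copies f g : Y f -> lmeasurable I g ->
  (forall t, 0 < t -> (rearrangement I g t <= rearrangement I f (15 / 16 * t)%R)%E) ->
  Y g /\ N g <= 2 * N f.
Proof.
move=> Yf mg gf; have s1 : 1 <= 16 / 15 :> R by lra.
pose G t := rearr f (t / (16 / 15)).
have [Yr _] := Y_rearr Yf.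
have mG : lmeasurable I G by apply: (lmeasurable_div hI s1); exact: Y_measurable.
have part (C : set (leb R)) : measurable C ->
    (forall z, 0 < z -> (lebm (C `&` `[0%R, z[) <= (15 / 16 * z)%R%:E)%E) ->
    Y (fun t => G t * \1_C t) /\ N (fun t => G t * \1_C t) <= N f.
  move=> mC Cz; apply: Y_dominated => //; first exact: lmeasurable_indic.
  (* At a height at least f^*(t), the level set of G restricted to C lies in C below 16/15 * t,
     hence has measure at most 15/16 * (16/15 * t) = t. *)
  move=> t t0; apply: rearr_distr_le => y y0 fy.
  have z0 : 0 < 16 / 15 * t by lra.
  apply: (@le_trans _ _ (lebm (C `&` `[0%R, (16 / 15 * t)%R[))); last first.
    by apply: le_trans (Cz _ z0) _; rewrite lee_fin; lra.
  apply: le_lebm => x /= [Ix]; rewrite indicE.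
  have [xC|xC] := boolP (x \in C); last by rewrite mulr0 normr0 ltNge y0.
  rewrite mulr1 => yG; split; first by rewrite inE in xC.
  rewrite in_itv/= (I_ge0 hI Ix)/=; rewrite ltNge; apply/negP => tx.
  have txz : t <= x / (16 / 15) by lra.
  move: yG; rewrite ltNge => /negP; apply; rewrite ger0_norm ?rearr_ge0r//.
  rewrite -lee_fin rearrE//; last by lra.
  by apply: rearr_le => //; apply: le_trans fy _; rewrite lee_fin.
have [|Y1 N1] := part _ measurable_fours; first by move=> z /lebm_fours_le[].
have [|Y2 N2] := part _ (measurableC measurable_fours).
  by move=> z /lebm_fours_le[].
have [YG NG] : Y G /\ N G <= 2 * N f.
  have YGG := Y_add Y1 Y2.
  have [|YG NG] := @Y_ae_eq _ G YGG.
    apply: ae_on_all => t _; rewrite -mulrDr !indicE in_setC.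
    by case: (t \in fours); rewrite /= ?addr0 ?add0r mulr1.
  split => //; rewrite NG mulr2n mulrDl !mul1r.
  by apply: le_trans (Y_normD Y1 Y2) _; exact: lerD.
have [|Yg Ng] := Y_rearr_le YG mg; last by split => //; apply: le_trans Ng _.
apply: ae_on_sub (ae_on_gt0 hI) _ => t _ t0.
rewrite /G rearrE//; last by lra.
by apply: le_trans (gf _ t0) _; rewrite (_ : t / _ = 15 / 16 * t)//; lra.
Qed.

(** For s >= 1 the point t / s stays in I, so this agrees on I with [dilation] and spares the
    membership test. *)
Definition dil s f : R -> R := fun t => f (t / s).

Lemma rearr_dil f s t : 1 <= s ->
  (rearrangement I (dil s f) t <= rearrangement I f (t / s)%R)%E.
Proof.
move=> s1; have s0 : 0 < s by lra.
apply: rearr_distr_le => y y0 fy; apply: (le_trans (distr_div hI _ _ s1)).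
rewrite (_ : t%:E = s%:E * (t / s)%R%:E)%E; first by apply: lee_pmul => //; rewrite ?lee_fin ?lebm_ge0; lra.
by rewrite -EFinM mulrC divfK// gt_eqF.
Qed.

Lemma Y_dil_small s f : 1 <= s -> s <= 16 / 15 -> Y f ->
  Y (dil s f) /\ N (dil s f) <= 2 * N f.
Proof.
move=> s1 s16 Yf; apply: Y_two_copies => //.
  by apply: (lmeasurable_div hI) => //; exact: Y_measurable.
move=> t t0; apply: le_trans (rearr_dil _ _ s1) _.
apply: rearr_nonincr; rewrite mulrC ler_pM2l// -[leLHS]invrK lef_pV2 ?posrE; lra.
Qed.

Lemma dilM s u f : 1 <= s -> 1 <= u -> dil s (dil u f) = dil (s * u) f.
Proof.
by move=> s1 u1; apply/funext => t; rewrite /dil invfM mulrA.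
Qed.

(** A dilation is a product of dilations by at most 16/15, each costing a factor 2. The bound is
    crude, but it is uniform for s <= S, as Fekete's lemma requires. *)
Lemma Y_dil_bounded S : exists2 K, 0 <= K & forall s f, 1 <= s -> s <= S -> Y f ->
  Y (dil s f) /\ N (dil s f) <= K * N f.
Proof.
have H n : forall s f, 1 <= s -> s <= (16 / 15) ^+ n -> Y f ->
    Y (dil s f) /\ N (dil s f) <= 2 ^+ n * N f.
  elim: n => [|n IH] s f s1 sn Yf.
    have -> : dil s f = f.
      by apply/funext => t; rewrite /dil (_ : s = 1) ?divr1//; move: sn; rewrite expr0; lra.
    by rewrite expr0 mul1r.
  have [sn1|sn1] := lerP s ((16 / 15) ^+ n).
    have [Yd Nd] := IH _ _ s1 sn1 Yf; split => //.
    apply: (le_trans Nd); rewrite ler_wpM2r ?Y_norm_ge0// exprS.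
    by rewrite ler_peMl ?exprn_ge0//; lra.
  have p1 : 1 <= (16 / 15 : R) ^+ n by rewrite exprn_ege1//; lra.
  have p0 : 0 < (16 / 15 : R) ^+ n by lra.
  have [Yd Nd] := IH _ _ p1 (lexx _) Yf.
  have u1 : 1 <= s / (16 / 15) ^+ n by rewrite ler_pdivlMr// mul1r ltW.
  have u2 : s / (16 / 15) ^+ n <= 16 / 15 by rewrite ler_pdivrMr// -exprS.
  have [Ydd Ndd] := Y_dil_small u1 u2 Yd.
  have <- : dil (s / (16 / 15) ^+ n) (dil ((16 / 15) ^+ n) f) = dil s f.
    by rewrite dilM// divfK// gt_eqF.
  split => //; apply: (le_trans Ndd); rewrite exprS -mulrA ler_pM2l//.
have [|n Sn] := @exprn_unbounded _ (16 / 15) S; first by lra.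
exists (2 ^+ n); first exact: exprn_ge0.
by move=> s f s1 sS; apply: H => //; exact: le_trans Sn.
Qed.

End rearrangement_invariant_space.

(** * The upper Boyd index *)

Section submultiplicative.
Context {R : realType}.

(* Fekete's lemma for submultiplicative functions *)
Lemma submultiplicative_cvg (h : R -> R) :
  (forall s, 1 <= s -> 1 <= h s) ->
  (forall s u, 1 <= s -> 1 <= u -> h (s * u) <= h s * h u) ->
  (forall S, exists K, forall s, 1 <= s -> s <= S -> h s <= K) ->
  exists2 L, (ln (h s) / ln s) @[s --> +oo] --> L &
    forall s, 1 < s -> L <= ln (h s) / ln s.
Proof.
move=> h1 hM hK.
pose E := [set ln (h s) / ln s | s in [set s | 1 < s]].
have E0 : lbound E 0.
  move=> _ [s /= s1 <-]; apply: divr_ge0; last by rewrite ln_ge0// ltW.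
  by rewrite ln_ge0// h1// ltW.
have infE : has_inf E by split; [exists (ln (h 2) / ln 2), 2 => //=; lra|exists 0].
have hpow s n : 1 <= s -> h (s ^+ n) <= h s ^+ n * h 1.
  move=> s1; elim: n => [|n IH]; first by rewrite !expr0 mul1r.
  have sn1 : 1 <= s ^+ n by rewrite exprn_ege1.
  rewrite !exprS -mulrA; apply: (le_trans (hM _ _ s1 sn1)).
  by rewrite ler_pM2l//; have := h1 _ s1; lra.
have LE s : 1 < s -> inf E <= ln (h s) / ln s.
  by move=> s1; apply: ge_inf; [exists 0|exists s].
exists (inf E) => //.
apply/cvgrPdist_lt => e e0.
have e20 : 0 < e / 2 by lra.
have [_ [s0 /= s01 <-] s0e] := inf_adherent e20 infE.
have [K Kh] := hK s0.
have K1 : 1 <= K by apply: le_trans (h1 _ (lexx _)) (Kh _ (lexx _) _); lra.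
have h11 := h1 _ (lexx 1).
have ls0 : 0 < ln s0 by rewrite ln_gt0.
(* The loss against the exact power of s0: the factor h 1 comes from the case n = 0 of [hpow], and K
   bounds h on the remaining quotient in [1, s0]. It disappears on division by ln s. *)
pose C := ln (h 1 * K).
have C0 : 0 <= C by rewrite ln_ge0// mulr_ege1.
near=> s.
have s1 : 1 < s by near: s; exact: nbhs_pinfty_gt.
have ls : 0 < ln s by rewrite ln_gt0.
have sC : C < e / 2 * ln s.
  have s0' : 0 < s by lra.
  rewrite -ltr_pdivrMl// -[ltLHS]expRK ltr_ln ?posrE ?expR_gt0//.
rewrite distrC ger0_norm; last by rewrite subr_ge0; exact: LE.
have [n /andP[ns sn]] : exists n, s0 ^+ n <= s < s0 ^+ n.+1.
  have ex : exists n, s < s0 ^+ n.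
    by have [n sn] := exprn_unbounded (s + 1) s01; exists n; lra.
  case: (ex_minnP ex) => -[|n] sn nmin; first by move: sn; rewrite expr0; lra.
  by exists n; rewrite sn andbT leNgt; apply/negP => /nmin; rewrite ltnn.
have p0 : 0 < s0 ^+ n by rewrite exprn_gt0//; lra.
have u1 : 1 <= s / s0 ^+ n by rewrite ler_pdivlMr// mul1r.
have u2 : s / s0 ^+ n <= s0 by rewrite ler_pdivrMr// -exprS ltW.
have s0n1 : 1 <= s0 ^+ n by rewrite exprn_ege1//; lra.
have hs : h s <= h s0 ^+ n * (h 1 * K).
  rewrite -[in leLHS](divfK (lt0r_neq0 p0) s) mulrC.
  apply: (le_trans (hM _ _ s0n1 u1)); rewrite mulrA.
  have := h1 _ s0n1; have := h1 _ u1 => ? ?.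
  by apply: ler_pM; [lra|lra|apply: hpow; lra|exact: Kh].
have hs0 : 1 <= h s0 by apply: h1; lra.
have hsn : 0 < h s0 ^+ n by rewrite exprn_gt0//; lra.
have lnhs : ln (h s) <= n%:R * ln (h s0) + C.
  rewrite mulr_natl -lnXn; last by lra.
  rewrite -lnM ?posrE//; last by rewrite mulr_gt0//; lra.
  rewrite ler_ln ?posrE//; first by have := h1 _ (ltW s1); lra.
  by rewrite mulr_gt0// mulr_gt0//; lra.
have nls : n%:R * ln s0 <= ln s.
  rewrite mulr_natl -lnXn; last by lra.
  by rewrite ler_ln ?posrE//; lra.
have lh0 : 0 <= ln (h s0) by rewrite ln_ge0.
rewrite ltrBlDr ltr_pdivrMr//.
have : n%:R * ln (h s0) <= ln s * (ln (h s0) / ln s0).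
  rewrite mulrA ler_pdivlMr// -mulrA mulrCA [leRHS]mulrC.
  by rewrite ler_wpM2l.
have : ln s * (ln (h s0) / ln s0) <= ln s * (inf E + e / 2) by rewrite ler_pM2l// ltW.
lra.
Unshelve. all: by end_near. Qed.

End submultiplicative.

Section boyd_index.
Context {R : realType} (I : set R).
Hypothesis hI : I = `[0, 1]%classic \/ I = `[0, +oo[%classic.
Context (Y : fspace R) (hY : banach_ri I Y).
Implicit Types (f g : R -> R).

Local Notation "'N'" := (qnorm Y).
Local Notation h := (fun s => operator_norm Y (dilation I s)).

Lemma Y_dilation s f : 1 <= s -> Y f ->
  [/\ Y (dilation I s f), Y (dil s f) & N (dilation I s f) = N (dil s f)].
Proof.
move=> s1 Yf; have [K _ /(_ s f s1 (lexx _) Yf)[Yd _]] := Y_dil_bounded hI hY s.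
have [|? ?] := Y_ae_eq hY (g := dilation I s f) Yd; last by split.
apply: ae_on_all => t It; rewrite /dilation /dil; case: asboolP => // -[].
by split => //; exact: (I_div hI).
Qed.

Lemma Y_dil_le s f : 1 <= s -> Y f -> N (dil s f) <= h s * N f.
Proof.
move=> s1 Yf; have [K K0 hK] := Y_dil_bounded hI hY s.
(* The real supremum in [operator_norm] bounds its set only once that set is known to be bounded
   above. *)
have ub : has_ubound [set N (dilation I s f) | f in [set f | Y f /\ N f <= 1]].
  exists K => _ [g /= [Yg Ng] <-]; have [_ _ ->] := Y_dilation s1 Yg.
  have [_ /le_trans] := hK s g s1 (lexx _) Yg; apply.
  by rewrite ler_piMr.
have [Nf0|Nf0] := eqVneq (N f) 0.
  by have [_] := hK s f s1 (lexx _) Yf; rewrite Nf0 !mulr0.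
have Nf : 0 < N f by rewrite lt_neqAle eq_sym Nf0 (Y_norm_ge0 hY).
have Nf' : 0 <= (N f)^-1 by rewrite invr_ge0 ltW.
rewrite -ler_pdivrMr//; apply: ub_le_sup => //.
have Yfn := Y_scale hY (N f)^-1 Yf.
exists (fun t => (N f)^-1 * f t).
  by split => //=; rewrite (Y_normZ hY)// ger0_norm// mulVf.
have [_ _ ->] := Y_dilation s1 Yfn.
have [_ Yd _] := Y_dilation s1 Yf.
have := Y_normZ hY (N f)^-1 Yd; rewrite /dil => ->.
by rewrite ger0_norm// mulrC.
Qed.

Definition indic01 : R -> R := \1_(`[0, 1]%classic : set R).

(** A nonzero element of Y, used to bound operator norms from below, to compare f^*(t) with the norm
    of f, and to build a majorant in [embeds_low]. *)
Lemma Y_indic01 : Y indic01 /\ 0 < N indic01.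
Proof.
pose u := indic01.
have mu01 : lmeasurable I u by apply: measurable_indic; exact: leb_measurable_itv.
have [_ _ rY _] := hY.
have Yu : Y u.
  apply: (ri_simple rY) => //.
    apply: (@sub_finite_set _ _ [set 0; 1]); last exact: finite_set2.
    by move=> _ [t _ <-]; rewrite /u /indic01 indicE; case: (t \in _); [right|left].
  apply: (@integrableS _ _ _ _ setT) => //; first exact: I_measurable.
  apply/integrableP; split.
    by apply/measurable_EFinP; apply: measurable_indic; exact: leb_measurable_itv.
  have -> : (\int[@lebm R]_x `|(EFin \o u) x| = lebm (`[0%R, 1%R]%classic : set R))%E.
    rewrite -[X in lebm X]setIT -integral_indic//; last exact: leb_measurable_itv.
    by apply: eq_integral => x _ /=; rewrite ger0_norm.
  by rewrite lebm_itv/= lte_fin ltr01 oppr0 adde0 ltry.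
split => //; rewrite lt_neqAle (Y_norm_ge0 hY)// andbT eq_sym; apply/eqP.
move/(Y_norm0 hY Yu)/ae_onE => u0.
have : (lebm (`[0%R, 1%R] : set R) <= 0)%E.
  rewrite -u0; apply: le_lebm => t /= t01; split.
    by move: t01; rewrite in_itv/= => /andP[? ?]; apply: (I_le hI (I1 hI)).
  by rewrite /u /indic01 indicE mem_set//= => /eqP; rewrite oner_eq0.
by rewrite lebm_itv/= lte_fin ltr01 oppr0 adde0 lee_fin ler10.
Qed.

(** The dilate of the indicator of [0, 1] dominates that indicator. *)
Lemma opnorm_ge1 s : 1 <= s -> 1 <= h s.
Proof.
move=> s1; have [Yu Nu] := Y_indic01; set u := indic01 in Yu Nu.
have := Y_dil_le s1 Yu => hu.
rewrite -(ler_pM2r Nu); apply: le_trans hu; rewrite mul1r.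
have [_ Yd _] := Y_dilation s1 Yu.
have [|//] := Y_lattice hY Yd (Y_measurable hY Yu).
apply: ae_on_all => t It; rewrite /dil /u /indic01 !indicE.
have [t01|t01] := boolP (t \in _); last by rewrite normr0.
rewrite mem_set//=; move: t01; rewrite inE/= !in_itv/= => /andP[t0 t1].
rewrite divr_ge0//=; last by lra.
rewrite ler_pdivrMr; lra.
Qed.

Lemma opnorm_le s c : 1 <= s -> 0 <= c ->
  (forall f, Y f -> N (dil s f) <= c * N f) -> h s <= c.
Proof.
move=> s1 c0 hc; apply: ge_sup.
  have [Yu Nu] := Y_indic01; set u := indic01 in Yu Nu *.
  have Y0 := Y_scale hY 0 Yu.
  exists (N (dilation I s (fun t => 0 * u t))), (fun t => 0 * u t) => //=.
  by split => //; rewrite (Y_normZ hY)// normr0 mul0r.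
move=> _ [g /= [Yg Ng] <-]; have [_ _ ->] := Y_dilation s1 Yg.
by apply: (le_trans (hc _ Yg)); rewrite ler_piMr.
Qed.

Lemma opnormM s u : 1 <= s -> 1 <= u -> h (s * u) <= h s * h u.
Proof.
move=> s1 u1; have := opnorm_ge1 s1; have := opnorm_ge1 u1 => hu hs.
apply: opnorm_le; [by rewrite mulr_ege1|by apply: mulr_ge0; lra|] => f Yf.
rewrite -dilM//; have [_ Yd _] := Y_dilation u1 Yf.
apply: (le_trans (Y_dil_le s1 Yd)); rewrite -mulrA ler_pM2l//; last by lra.
exact: Y_dil_le.
Qed.

Lemma opnorm_bounded S : exists K, forall s, 1 <= s -> s <= S -> h s <= K.
Proof.
have [K K0 hK] := Y_dil_bounded hI hY S.
by exists K => s s1 sS; apply: opnorm_le => // f Yf; have [] := hK s f s1 sS Yf.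
Qed.

Lemma upper_boyd_index_cvg : exists2 L,
  (ln (h s) / ln s) @[s --> +oo] --> L & forall s, 1 < s -> L <= ln (h s) / ln s.
Proof.
apply: submultiplicative_cvg; [exact: opnorm_ge1|exact: opnormM|exact: opnorm_bounded].
Qed.

Lemma upper_boyd_index_lt a s : 1 < s -> h s < s `^ a -> upper_boyd_index I Y < a.
Proof.
move=> s1 hs; have [L cL hL] := upper_boyd_index_cvg.
rewrite /upper_boyd_index (cvg_lim _ cL)//.
apply: le_lt_trans (hL _ s1) _; rewrite ltr_pdivrMr ?ln_gt0//.
have s0 : 0 < s by lra.
rewrite -ln_powR ltr_ln ?posrE ?powR_gt0//.
by have := opnorm_ge1 (ltW s1); lra.
Qed.

(** Take for b the midpoint of the index and a; it is positive because h >= 1 makes the index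
    nonnegative. The bound h s <= s^b holds beyond some M, and the constant absorbs the values on
    [1, M]. *)
Lemma upper_boyd_index_bound a : upper_boyd_index I Y < a ->
  exists b C, [/\ 0 < b, b < a, 0 <= C &
    forall s f, 1 <= s -> Y f -> Y (dil s f) /\ N (dil s f) <= C * s `^ b * N f].
Proof.
have [L cL hL] := upper_boyd_index_cvg.
rewrite /upper_boyd_index (cvg_lim _ cL)// => La.
have L0 : 0 <= L.
  rewrite -(cvg_lim _ cL)//; apply: limr_ge; first by apply/cvg_ex; exists L.
  near=> s; have s1 : 1 < s by near: s; exact: nbhs_pinfty_gt.
  by apply: divr_ge0; rewrite ln_ge0// ?opnorm_ge1// ltW.
pose b := (L + a) / 2; have b0 : 0 < b by rewrite /b; lra.
have ba : b < a by rewrite /b; lra.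
have : \forall s \near +oo, h s <= s `^ b.
  have : \forall s \near +oo, ln (h s) / ln s < b.
    by apply: (cvgr_lt L) => //; rewrite /b; lra.
  move=> H; near=> s.
  have s1 : 1 < s by near: s; exact: nbhs_pinfty_gt.
  have : ln (h s) / ln s < b by near: s.
  rewrite ltr_pdivrMr ?ln_gt0// -ln_powR ltr_ln ?posrE; first by move/ltW.
    by have := opnorm_ge1 (ltW s1); lra.
  by rewrite powR_gt0//; lra.
move=> [M [_ HM]]; have [K hK] := opnorm_bounded M.
have CK : 0 <= `|K| + 1 by rewrite addr_ge0.
exists b, (`|K| + 1); split => // s f s1 Yf.
have [_ Yd _] := Y_dilation s1 Yf; split => //.
apply: (le_trans (Y_dil_le s1 Yf)); rewrite ler_wpM2r ?(Y_norm_ge0 hY)//.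
have sb1 : 1 <= s `^ b by rewrite -(powRr0 s) ler_powR// ltW.
have [sM|sM] := lerP s M.
  apply: (le_trans (hK _ s1 sM)); apply: (le_trans (ler_norm K)).
  have := normr_ge0 K; nra.
apply: (le_trans (HM _ sM)); have := normr_ge0 K; nra.
Unshelve. all: by end_near. Qed.

End boyd_index.

(** * Lorentz norms on dyadic blocks *)

Lemma measurable_invr (R : realType) : measurable_fun [set: R] (fun x : R => x^-1).
Proof.
have -> : [set: R] = [set 0] `|` ~` [set 0] by rewrite setUCr.
apply/measurable_funU => //; first exact: measurableC.
split; first exact: measurable_fun_set1.
apply: open_continuous_measurable_fun; first by apply: closed_openC; apply: accessible_closed_set1; exact: hausdorff_accessible.
by move=> x /=; rewrite inE/= => /eqP; exact: inv_continuous.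
Qed.

(** * Essential bounds and truncation at a level *)

Section bounded_functions.
Context {R : realType} (I : set R).
Hypothesis hI : I = `[0, 1]%classic \/ I = `[0, +oo[%classic.
Implicit Types (f g : R -> R).

(** [Lnorm] at exponent +oo is an essential supremum only when the whole space has positive
    measure. *)
Let lebmT_gt0 : (0 < @lebm R setT)%E.
Proof.
apply: (@lt_le_trans _ _ (lebm (`[0%R, 1%R]%classic : set R))).
  by rewrite lebm_itv/= lte_fin ltr01 oppr0 adde0 lte_fin.
exact: le_lebm.
Qed.

Lemma Linfty_normE f c : (0 <= c%:E)%E ->
  (Linfty_norm I f <= c%:E)%E <-> ae_on I (fun t => `|f t| <= c).
Proof.
move=> c0; rewrite /Linfty_norm unlock /= lebmT_gt0.
have EE (x : leb R) : ((abse \o ((EFin \o f : leb R -> \bar R) \_ (I : set (leb R)))) x <= c%:E)%E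
    = (I x -> `|f x| <= c) :> Prop.
  apply/propext => /=; rewrite patchE.
  have [Ix|Ix] := boolP (x \in _).
    by rewrite inE in Ix; split=> [|/(_ Ix)]; rewrite lee_fin.
  split=> [_ Ix'|_]; last by rewrite abse0.
  by move: Ix; rewrite mem_set.
have E : (\forall x \ae @lebm R, (abse \o ((EFin \o f : leb R -> \bar R) \_ (I : set (leb R)))) x <= c%:E)%E
    = ae_on I (fun t => `|f t| <= c).
  rewrite /ae_on; congr (almost_everywhere _ _); apply/funext => x; exact: EE.
by split=> [/ess_supP|] h; [rewrite -E|apply/ess_supP; rewrite E].
Qed.

Lemma Linfty_norm_ge0 f : (0 <= Linfty_norm I f)%E.
Proof. by rewrite /Linfty_norm; exact: Lnorm_ge0. Qed.

Lemma LinftyP f : Linfty I f -> ae_on I (fun t => `|f t| <= qnorm (Linfty I) f).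
Proof.
move=> -[mf foo]; apply/Linfty_normE; first by rewrite lee_fin fine_ge0// Linfty_norm_ge0.
by rewrite /= fineK// ge0_fin_numE ?Linfty_norm_ge0.
Qed.

Lemma Linfty_bounded f c : lmeasurable I f -> 0 <= c -> ae_on I (fun t => `|f t| <= c) ->
  Linfty I f /\ qnorm (Linfty I) f <= c.
Proof.
move=> mf c0 /Linfty_normE; rewrite lee_fin => /(_ c0) fc.
have foo : (Linfty_norm I f < +oo)%E by apply: le_lt_trans fc _; rewrite ltry.
split; first by split.
by rewrite /= -lee_fin fineK// ge0_fin_numE ?Linfty_norm_ge0.
Qed.

Lemma Linfty_qnorm_ge0 f : 0 <= qnorm (Linfty I) f.
Proof. by rewrite /= fine_ge0// Linfty_norm_ge0. Qed.

Definition top y f : R -> R := fun t => if y < `|f t| then f t else 0.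
Definition bot y f : R -> R := fun t => if y < `|f t| then 0 else f t.

Lemma top_bot y f t : f t = top y f t + bot y f t.
Proof. by rewrite /top /bot; case: ifPn; rewrite ?addr0 ?add0r. Qed.

Lemma lmeasurable_top y f : lmeasurable I f -> lmeasurable I (top y f).
Proof.
move=> mf; have mI := I_measurable hI.
have mA := lmeasurable_lt y mI mf.
apply: (lmeasurable_ae _ (lmeasurable_indic mA mf)).
apply: ae_on_all => t It; rewrite /top indicE.
case: ifPn => yf; first by rewrite mem_set ?mulr1.
by rewrite memNset ?mulr0// => -[_ /=]; apply/negP.
Qed.

Lemma lmeasurable_bot y f : lmeasurable I f -> lmeasurable I (bot y f).
Proof.
move=> mf; have := lmeasurableD mf (lmeasurableZ (-1) (lmeasurable_top y mf)).
apply: lmeasurable_ae; apply: ae_on_all => t _.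
by rewrite {1}(top_bot y f) mulN1r addrAC subrr add0r.
Qed.

Lemma bot_le y f t : 0 <= y -> `|bot y f t| <= y.
Proof. by rewrite /bot; case: ltP => //; rewrite normr0. Qed.

Lemma top_le y f t : `|top y f t| <= `|f t|.
Proof. by rewrite /top; case: ifP; rewrite ?normr0. Qed.

Lemma rearr_top_le y f t :
  (rearrangement I (top y f) t <= rearrangement I f t)%E.
Proof.
apply: rearr_distr_le => z z0; apply: le_trans.
by apply: distr_ae_le; apply: ae_on_all => s _; exact: top_le.
Qed.

Lemma rearr_top0 y f s t : 0 <= y -> (distr I f y <= s%:E)%E -> s <= t ->
  rearrangement I (top y f) t = 0%E.
Proof.
move=> y0 fs st; apply/eqP; rewrite eq_le rearr_ge0 andbT.
apply: rearr_le => //; apply: (@le_trans _ _ s%:E); last by rewrite lee_fin.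
apply: le_trans fs; apply: le_lebm => x /= [Ix]; rewrite /top.
by case: ifPn => [yf _|_]; [split|rewrite normr0 ltxx].
Qed.

(** Up to a null set, the level set of |h| at height y + c lies in that of |f| at height y. *)
Lemma rearr_add_bounded f g h c t : 0 <= c -> ae_on I (fun t => h t = f t + g t) ->
  ae_on I (fun t => `|g t| <= c) ->
  (rearrangement I h t <= rearrangement I f t + c%:E)%E.
Proof.
move=> c0 hfg gc; rewrite -leeBlDr//; apply: le_ereal_inf_tmp => _ [y [y0 fy] <-].
rewrite leeBlDr// -EFinD; apply: rearr_le; first exact: addr_ge0.
apply: le_trans fy; apply: (@le_trans _ _ (distr I (fun x => `|f x| + c) (y + c))).
  apply: distr_ae_le; apply: ae_on_sub2 hfg gc _ => x _ -> gx.
  rewrite [leRHS]ger0_norm ?addr_ge0//.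
  by apply: (le_trans (ler_normD (f x) (g x))); rewrite lerD2l.
apply: le_lebm => x /= [Ix]; rewrite ger0_norm ?addr_ge0// ltrD2r.
by move=> ?; split.
Qed.

End bounded_functions.

Section lorentz_dyadic_bound.
Context {R : realType} (I : set R).
Hypothesis hI : I = `[0, 1]%classic \/ I = `[0, +oo[%classic.
Implicit Types (f g : R -> R).
Context (p : R) (hp : 1 <= p).
Local Notation a := (p^-1).

Let p0 : 0 < p. Proof. exact: lt_le_trans hp. Qed.
Let a0 : 0 < a. Proof. by rewrite invr_gt0. Qed.

Definition lorentz_integrand (r : R) g (t : leb R) : \bar R :=
  (((((t : R) `^ a)%:E * rearrangement I g t) `^ r) * ((t : R)^-1)%:E)%E.

Lemma lorentz_normE r g :
  lorentz_norm I p r%:E g =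
  ((\int[@lebm R]_(t in (I : set (leb R))) lorentz_integrand r g t) `^ r^-1)%E.
Proof. by []. Qed.

Lemma measurable_lorentz_integrand r g (D : set (leb R)) : measurable D ->
  measurable_fun D (lorentz_integrand r g).
Proof.
move=> mD; apply: emeasurable_funM; last first.
  apply/measurable_EFinP; apply: (@measurable_funTS _ _ _ _ D (fun t : leb R => (t : R)^-1)).
  apply: (@borel_fun_lebesgue R setT (fun t => t^-1)) => //.
  exact: measurable_invr.
apply: (measurableT_comp (measurable_poweR r)).
apply: emeasurable_funM; last exact: measurable_rearr.
apply/measurable_EFinP; apply: (@measurable_funTS _ _ _ _ D (fun t : leb R => (t : R) `^ a)).
exact: (@borel_fun_lebesgue R setT (fun t => t `^ a)).
Qed.

Lemma lorentz_integrand_ge0 r g t : I t -> (0 <= lorentz_integrand r g t)%E.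
Proof.
move=> /(I_ge0 hI) t0; apply: mule_ge0; last by rewrite lee_fin invr_ge0.
exact: poweR_ge0.
Qed.

Lemma lorentz_norm_ge0 r g : (0 <= lorentz_norm I p r g)%E.
Proof.
case: r => [r| |] //=; first exact: poweR_ge0.
apply: ereal_sup_ubound; exists 0; first by apply: (I_le hI (I1 hI)).
by rewrite powR0 ?mul0e// gt_eqF.
Qed.

Lemma dyadic_interval (s t : R) : 0 < s -> s <= t ->
  exists k, t / 2 ^+ k.+1 < s <= t / 2 ^+ k.
Proof.
move=> s0 st.
have ex : exists k, t / 2 ^+ k < s.
  have [k tk] := @exprn_unbounded R 2 (t / s + 1) (ltr1n _ _).
  by exists k; rewrite ltr_pdivrMr ?exprn_gt0// mulrC -ltr_pdivrMr//; lra.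
case: (ex_minnP ex) => -[|k] tk kmin; first by move: tk; rewrite expr0; lra.
by exists k; rewrite tk/= leNgt; apply/negP => /kmin; rewrite ltnn.
Qed.

(* The dyadic blocks ]t / 2^(k+1), t / 2^k] reduce the Lorentz norm to a series *)
Lemma lorentz_dyadic g (phi : R -> R) (t w : R) : 0 < t ->
  (forall s, t <= s -> rearrangement I g s = 0%E) ->
  (forall s, 0 < s -> (rearrangement I g s <= (phi s)%:E)%E) ->
  (forall s u, 0 < s -> s <= u -> phi u <= phi s) ->
  (forall s, 0 < s -> 0 <= phi s) ->
  (forall n, \sum_(k < n) (t / 2 ^+ k) `^ a * phi (t / 2 ^+ k.+1) <= w) ->
  (lorentz_norm I p +oo%E g <= w%:E)%E /\
  (forall r, 1 <= r -> (lorentz_norm I p r%:E g <= w%:E)%E).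
Proof.
move=> t0 gt gphi phid phi0 phiw.
pose x k := (t / 2 ^+ k) `^ a * phi (t / 2 ^+ k.+1).
have tk0 k : 0 < t / 2 ^+ k by rewrite divr_gt0// exprn_gt0.
have x0 k : 0 <= x k by rewrite mulr_ge0 ?powR_ge0 ?phi0.
have xw k : x k <= w.
  apply: le_trans (phiw k.+1); rewrite big_ord_recr/= lerDr.
  by apply: sumr_ge0 => i _; exact: x0.
have w0 : 0 <= w by apply: le_trans (xw 0%N); exact: x0.
have blk k s : t / 2 ^+ k.+1 < s <= t / 2 ^+ k ->
    ((s `^ a)%:E * rearrangement I g s <= (x k)%:E)%E.
  move=> /andP[ks sk]; have s0 : 0 < s by apply: lt_trans ks; exact: tk0.
  rewrite /x EFinM; apply: lee_pmul; rewrite ?lee_fin ?powR_ge0 ?rearr_ge0//.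
    by rewrite ge0_ler_powR// ?nnegrE ltW.
  by apply: le_trans (gphi _ s0) _; rewrite lee_fin phid// ltW.
have outside s : I s -> ~ (0 < s <= t) -> s = 0 \/ rearrangement I g s = 0%E.
  move=> /(I_ge0 hI); rewrite le_eqVlt => /orP[/eqP <-|s0]; first by left.
  by move=> /negP; rewrite s0/= -ltNge => ts; right; apply: gt; exact: ltW.
split.
  apply: ge_ereal_sup => _ [s Is <-].
  have [/andP[s0 st]|ns] := pselect (0 < s <= t).
    have [k sk] := dyadic_interval s0 st.
    by apply: (le_trans (blk _ _ sk)); rewrite lee_fin.
  have [->|->] := outside _ Is ns; last by rewrite mule0 lee_fin.
  by rewrite powR0 ?mul0e ?lee_fin// gt_eqF.
move=> r r1; have r0 : 0 < r by lra.
rewrite lorentz_normE.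
pose J k : set (leb R) := `](t / 2 ^+ k.+1), (t / 2 ^+ k)]%classic.
(* The length of the block is its left end t / 2^(k+1), so [c k] times this length is exactly x k ^
   r. *)
pose c k := x k `^ r / (t / 2 ^+ k.+1).
have c0 k : 0 <= c k by rewrite divr_ge0 ?powR_ge0// ltW.
have mJ k : measurable (J k) by exact: leb_measurable_itv.
have lenJ k : lebm (J k) = (t / 2 ^+ k.+1)%:E.
  have tt : t / 2 ^+ k.+1 < t / 2 ^+ k.
    by rewrite exprS invfM mulrCA; have := tk0 k; lra.
  rewrite lebm_itv/= lte_fin tt -EFinB; congr _%:E.
  by rewrite exprS invfM mulrCA; lra.
have mI := I_measurable hI.
have cJ n z : (0 <= (c n)%:E * (\1_(J n) z)%:E)%E by rewrite mule_ge0 ?lee_fin.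
have mcJ n : measurable_fun (I : set (leb R)) (fun z : leb R => ((c n)%:E * (\1_(J n) z)%:E)%E).
  apply: emeasurable_funM; first exact: measurable_cst.
  by apply/measurable_EFinP; exact: measurable_indic.
have step : (\int[@lebm R]_(t in (I : set (leb R))) lorentz_integrand r g t <=
   \int[@lebm R]_(z in (I : set (leb R))) \sum_(0 <= k <oo) ((c k)%:E * (\1_(J k) z)%:E))%E.
  apply: (@ge0_le_integral _ _ _ (@lebm R) _ mI).
  - by move=> z Iz; exact: lorentz_integrand_ge0.
  - exact: measurable_lorentz_integrand.
  - by apply: ge0_emeasurable_sum => // n z _; exact: cJ.
  move=> z Iz.
  have [/andP[z0 zt]|ns] := pselect (0 < z <= t).
    have [k zk] := dyadic_interval z0 zt.
    apply: (@le_trans _ _ ((c k)%:E * (\1_(J k) z)%:E)%E); last first.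
      apply: le_trans (nneseries_lim_ge k.+1 _); last by move=> n _ _; exact: cJ.
      by rewrite big_nat_recr//= leeDr// sume_ge0.
    rewrite indicE mem_set; last by rewrite /J/= in_itv.
    rewrite mule1 /lorentz_integrand /c EFinM.
    apply: lee_pmul.
    - exact: poweR_ge0.
    - by rewrite lee_fin invr_ge0 ltW.
    - rewrite -[leRHS]poweR_EFin; apply: gt0_ler_poweR; first exact: ltW.
      + by rewrite in_itv/= leey andbT mule_ge0 ?lee_fin ?powR_ge0 ?rearr_ge0.
      + by rewrite in_itv/= leey andbT lee_fin.
      + exact: blk.
    - by rewrite lee_fin lef_pV2 ?posrE//; case/andP: zk => /ltW.
  rewrite (_ : lorentz_integrand r g z = 0%E); first exact: nneseries_ge0.
  rewrite /lorentz_integrand; have [->|->] := outside _ Iz ns.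
    by rewrite invr0 mule0.
  by rewrite mule0 poweR0r ?mul0e// gt_eqF.
have {}step : (\int[@lebm R]_(t in (I : set (leb R))) lorentz_integrand r g t <=
   (w `^ r)%:E)%E.
  apply: (le_trans step); rewrite (@integral_nneseries _ _ _ (@lebm R) _ mI _ mcJ); last by move=> n z _; exact: cJ.
  apply: (@le_trans _ _ (\sum_(0 <= k <oo) (x k `^ r)%:E)%E).
    apply: lee_nneseries => [k _ _|k _]; first by apply: integral_ge0 => z _; exact: cJ.
    have mind : measurable_fun (I : set (leb R)) (fun z : leb R => (\1_(J k) z : R)%:E).
      by apply/measurable_EFinP; exact: measurable_indic.
    have ind0 z : I z -> (0 <= (\1_(J k) z : R)%:E)%E by rewrite lee_fin.
    rewrite (@ge0_integralZl _ _ _ (@lebm R) _ mI _ mind _ ind0); last by rewrite lee_fin.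
    rewrite (@integral_indic _ _ _ (@lebm R) _ mI _ (mJ k)); apply: (@le_trans _ _ ((c k)%:E * lebm (J k))%E).
      by rewrite lee_wpmul2l ?lee_fin// le_lebm.
    by rewrite lenJ -EFinM lee_fin /c divfK// gt_eqF.
  apply: lime_le; first by apply: is_cvg_nneseries => n _ _; rewrite lee_fin powR_ge0.
  apply: nearW => n; rewrite big_mkord sumEFin lee_fin.
  (* An l^1 bound controls all l^r sums: [x k] is at most w, hence x k ^ r <= w^(r-1) * x k. One
     hypothesis thus serves every exponent. *)
  apply: (@le_trans _ _ (\sum_(k < n) w `^ (r - 1) * x k)).
    apply: ler_sum => k _; rewrite -[r in x k `^ r](subrK 1) powRD; last by rewrite subrK (gt_eqF r0).
    rewrite powRr1// ler_wpM2r//; apply: ge0_ler_powR; rewrite ?nnegrE//; lra.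
  have -> : w `^ r = w `^ (r - 1) * w.
    by rewrite -{1}[r](subrK 1) powRD ?powRr1// subrK (gt_eqF r0).
  by rewrite -mulr_sumr ler_wpM2l ?powR_ge0//; exact: phiw.
apply: (@le_trans _ _ ((w `^ r)%:E `^ r^-1)%E).
  apply: gt0_ler_poweR => //; first by rewrite invr_ge0; lra.
  - rewrite in_itv/= leey andbT; apply: integral_ge0 => z Iz.
    exact: lorentz_integrand_ge0.
  - by rewrite in_itv/= leey andbT lee_fin powR_ge0.
by rewrite poweR_EFin -powRrM divff ?gt_eqF// powRr1.
Qed.

End lorentz_dyadic_bound.

(** * Interpolation from the Boyd index *)

Section lorentz_lower_bound.
Context {R : realType} (I : set R).
Hypothesis hI : I = `[0, 1]%classic \/ I = `[0, +oo[%classic.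
Context (p : R) (hp : 1 <= p).
Local Notation a := (p^-1).

Let p0 : 0 < p. Proof. exact: lt_le_trans hp. Qed.
Let a0 : 0 < a. Proof. by rewrite invr_gt0. Qed.

Lemma half_powR_ge (x : R) : 0 <= x -> x <= 1 -> 2^-1 <= 2^-1 `^ x :> R.
Proof.
move=> x0 x1; rewrite -[leLHS]powRr1; last by rewrite invr_ge0.
by rewrite ger_powR// invr_gt0 ltr0n/= invf_le1// ler1n.
Qed.

(** On ]s/2, s] the integrand is at least ((s/2)^a f^*(s))^r / s. Integration and the r-th root lose
    2^(-a) * 2^(-1/r) >= 1/4, whence the constant 4. *)
Lemma lorentz_lower (rr : \bar R) f s : (rr = +oo%E \/ exists2 r : R, 1 <= r & rr = r%:E) ->
  I s -> 0 < s ->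
  ((s `^ a)%:E * rearrangement I f s <= 4%:E * lorentz_norm I p rr f)%E.
Proof.
move=> hrr Is s0.
have sr0 : (0 <= (s `^ a)%:E * rearrangement I f s)%E.
  by rewrite mule_ge0 ?lee_fin ?powR_ge0 ?rearr_ge0.
case: hrr => [->|[r r1 ->]].
  apply: (@le_trans _ _ (lorentz_norm I p +oo%E f)).
    by apply: ereal_sup_ubound; exists s.
  rewrite -[leLHS]mul1e lee_wpmul2r ?lee_fin ?ler1n//.
  exact: lorentz_norm_ge0.
have r0 : 0 < r by lra.
have mI := I_measurable hI.
pose J : set (leb R) := `](s / 2), s]%classic.
have mJ : measurable J by exact: leb_measurable_itv.
have lenJ : lebm J = (s / 2)%:E.
  rewrite lebm_itv/= lte_fin (_ : s / 2 < s); last by lra.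
  by rewrite -EFinB; congr _%:E; lra.
have JI : J `<=` I.
  by move=> z; rewrite /J/= in_itv/= => /andP[sz zs]; apply: (I_le hI Is) => //; lra.
pose c := (((((s / 2) `^ a)%:E * rearrangement I f s) `^ r) * (s^-1)%:E)%E.
have c0 : (0 <= c)%E by rewrite mule_ge0 ?poweR_ge0// lee_fin invr_ge0 ltW.
have lb : (c * (s / 2)%:E <= \int[@lebm R]_(t in (I : set (leb R))) lorentz_integrand I p r f t)%E.
  apply: (@le_trans _ _ (\int[@lebm R]_(t in J) lorentz_integrand I p r f t)%E); last first.
    apply: (@ge0_subset_integral _ _ _ (@lebm R) _ _ mJ mI _ _ _ JI).
      exact: measurable_lorentz_integrand.
    by move=> z Iz; exact: (lorentz_integrand_ge0 hI).
  have -> : (c * (s / 2)%:E = \int[@lebm R]_(t in J) c)%E.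
    by rewrite -lenJ; apply/esym; exact: (integral_cst (@lebm R) mJ).
  apply: (@ge0_le_integral _ _ _ (@lebm R) _ mJ).
  - by move=> z _.
  - exact: measurable_cst.
  - exact: measurable_lorentz_integrand.
  move=> z; rewrite /J/= in_itv/= => /andP[sz zs].
  have z0 : 0 < z by lra.
  rewrite /c /lorentz_integrand; apply: lee_pmul.
  - exact: poweR_ge0.
  - by rewrite lee_fin invr_ge0 ltW.
  - apply: gt0_ler_poweR; first exact: ltW.
    + by rewrite in_itv/= leey andbT mule_ge0 ?lee_fin ?powR_ge0 ?rearr_ge0.
    + by rewrite in_itv/= leey andbT mule_ge0 ?lee_fin ?powR_ge0 ?rearr_ge0.
    + apply: lee_pmul; rewrite ?lee_fin ?powR_ge0 ?rearr_ge0//.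
        have s20 : 0 <= s / 2 by lra.
        by apply: ge0_ler_powR; rewrite ?nnegrE ?(ltW a0) ?(ltW z0) ?(ltW sz).
      exact: rearr_nonincr.
  - by rewrite lee_fin lef_pV2 ?posrE.
rewrite lorentz_normE.
set X := (\int[_]_(_ in _) _)%E in lb *.
have X0 : (0 <= X)%E by apply: le_trans lb; rewrite mule_ge0// lee_fin; lra.
pose v := (((s / 2) `^ a)%:E * rearrangement I f s)%E; rewrite /c -/v in lb.
have v0 : (0 <= v)%E by rewrite mule_ge0 ?lee_fin ?powR_ge0 ?rearr_ge0.
have lb1 : (v `^ r * (2^-1)%:E <= X)%E.
  apply: le_trans lb; rewrite -muleA -EFinM (_ : s^-1 * (s / 2) = 2^-1)//.
  by rewrite mulrA mulVf ?mul1r// gt_eqF.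
have ir1 : r^-1 <= 1 by rewrite invf_le1.
have lb2 : (v * (2^-1 `^ r^-1)%:E <= X `^ r^-1)%E.
  have := @gt0_ler_poweR R r^-1 _ _ _ _ _ lb1.
  rewrite poweRM ?poweR_ge0 ?lee_fin ?invr_ge0// -poweRrM divff ?gt_eqF// poweRe1// poweR_EFin.
  apply; rewrite ?invr_ge0 ?(ltW r0)// in_itv/= leey andbT// mule_ge0 ?poweR_ge0//.
apply: (@le_trans _ _ (4%:E * (v * (2^-1 `^ r^-1)%:E))%E); last by rewrite lee_wpmul2l ?lee_fin.
rewrite /v powRM ?invr_ge0 ?(ltW s0)// EFinM.
rewrite -!muleA [X in (_ * (_ * X))%E]muleC !muleA -!EFinM lee_wpmul2r ?rearr_ge0// lee_fin.
have h1 : 2^-1 <= 2^-1 `^ a :> R by rewrite half_powR_ge ?invf_le1// ltW.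
have h2 : 2^-1 <= 2^-1 `^ r^-1 :> R by rewrite half_powR_ge ?invr_ge0// ltW.
have h3 : 2^-1 * 2^-1 <= 2^-1 `^ a * 2^-1 `^ r^-1 :> R by apply: ler_pM; rewrite ?invr_ge0.
rewrite -!mulrA mulrCA ler_peMr ?powR_ge0//; lra.
Qed.

End lorentz_lower_bound.

Section interpolation_from_boyd_index.
Context {R : realType} (I : set R).
Hypothesis hI : I = `[0, 1]%classic \/ I = `[0, +oo[%classic.
Context (Y : fspace R) (hY : banach_ri I Y) (p : R) (hp : 1 <= p).
Implicit Types (f g : R -> R).

Local Notation "'N'" := (qnorm Y).
Local Notation a := (p^-1).

Context (b C : R) (b0 : 0 < b) (ba : b < a) (C0 : 0 <= C).
Hypothesis dil_bound : forall s f, 1 <= s -> Y f ->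
  Y (dil s f) /\ N (dil s f) <= C * s `^ b * N f.

Let a0 : 0 < a. Proof. exact: lt_trans ba. Qed.
Let mI := I_measurable hI.

Let theta k : R := (2 ^- k) `^ a.
(** This is 2^(b-a), the ratio of the geometric series that bounds the dilation series on Y; it is
    below 1 exactly because b < a. *)
Let rho : R := 2^-1 `^ a * 2 `^ b.

Lemma exprn_powR (x c : R) k : 0 <= x -> (x ^+ k) `^ c = (x `^ c) ^+ k.
Proof.
move=> x0; elim: k => [|k IH]; first by rewrite !expr0 powR1.
by rewrite !exprS powRM ?exprn_ge0// IH.
Qed.

Lemma geometric_sum_le (x : R) n : 0 <= x -> x < 1 -> \sum_(k < n) x ^+ k <= (1 - x)^-1.
Proof.
move=> x0 x1; have : (1 - x) * \sum_(k < n) x ^+ k = 1 - x ^+ n.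
  elim: n => [|n IH]; first by rewrite big_ord0 expr0 mulr0 subrr.
  by rewrite big_ord_recr/= mulrDr IH exprS; ring.
move=> E; rewrite -[leRHS]mul1r ler_pdivlMr; last by lra.
by rewrite mulrC E lerBlDr lerDl exprn_ge0.
Qed.

Let theta_ge0 k : 0 <= theta k. Proof. exact: powR_ge0. Qed.

Let thetaE k : theta k * (2 ^+ k.+1) `^ b = 2 `^ b * rho ^+ k.
Proof.
rewrite /theta /rho -exprVn !exprn_powR ?invr_ge0// exprMn exprS; ring.
Qed.

Let rho_ge0 : 0 <= rho. Proof. by rewrite mulr_ge0 ?powR_ge0. Qed.

Let rho_lt1 : rho < 1.
Proof.
have h : 2^-1 `^ a * 2 `^ a = 1 :> R by rewrite -powRM ?invr_ge0// mulVf// powR1.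
rewrite -h /rho ltr_pM2l; last by rewrite powR_gt0// invr_gt0.
by rewrite /powR pnatr_eq0/= ltr_expR ltr_pM2r// ln_gt0// ltr1n.
Qed.

Let S : R := 2 `^ b * (1 - rho)^-1.

Let S_ge0 : 0 <= S.
Proof. by rewrite mulr_ge0 ?powR_ge0// invr_ge0 subr_ge0 ltW. Qed.

Let sum_theta n : \sum_(k < n) theta k * (2 ^+ k.+1) `^ b <= S.
Proof.
under eq_bigr do rewrite thetaE.
by rewrite -mulr_sumr ler_wpM2l ?powR_ge0// geometric_sum_le.
Qed.

(** Plays the part of the maximal function: the partial sums have norms bounded by a geometric
    series, so the Fatou property yields one element of Y above all of them, and no infinite sum has
    to be manipulated. *)
Lemma dilation_series phi : Y phi -> (forall t, 0 <= phi t) -> exists G,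
  [/\ Y G, N G <= C * S * N phi & ae_on I (fun t => forall n,
     \sum_(k < n) theta k * phi (t / 2 ^+ k.+1) <= G t)].
Proof.
move=> Yphi phi0.
pose u n t := \sum_(k < n) theta k * phi (t / 2 ^+ k.+1).
have p1 k : 1 <= 2 ^+ k :> R by rewrite exprn_ege1// ler1n.
have Yu n : Y (u n) /\ N (u n) <= \sum_(k < n) C * (theta k * (2 ^+ k.+1) `^ b) * N phi.
  elim: n => [|n [IHY IHN]].
    have [|Y0 N0] := Y_ae_eq hY (g := u 0%N) (Y_scale hY 0 Yphi).
      by apply: ae_on_all => t _; rewrite mul0r /u big_ord0.
    by split=> //; rewrite N0 (Y_normZ hY)// normr0 mul0r big_ord0.
  have [Yd Nd] := dil_bound (p1 n.+1) Yphi.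
  have Yd' := Y_scale hY (theta n) Yd.
  have -> : u n.+1 = (fun t => u n t + theta n * dil (2 ^+ n.+1) phi t).
    by apply/funext => t; rewrite /u big_ord_recr.
  split; first exact: (Y_add hY).
  apply: (le_trans (Y_normD hY IHY Yd')); rewrite big_ord_recr/= lerD//.
  rewrite (Y_normZ hY)// ger0_norm//.
  apply: (le_trans (ler_wpM2l (theta_ge0 n) Nd)).
  by rewrite !mulrA [theta n * C]mulrC.
have Nu n : N (u n) <= C * S * N phi.
  apply: (le_trans (Yu n).2).
  rewrite -mulr_suml ler_wpM2r ?(Y_norm_ge0 hY)// -mulr_sumr ler_wpM2l//.
have [_ _ rY _] := hY.
have [||G [YG GE NG]] := ri_fatou rY (fun n => (Yu n).1).
- move=> m; apply: ae_on_all => t _; rewrite /u; split.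
    by apply: sumr_ge0 => k _; rewrite mulr_ge0.
  by rewrite big_ord_recr/= lerDl mulr_ge0.
- by exists (C * S * N phi) => _ [n _ <-].
exists G; split => //.
  by rewrite NG; apply: ge_sup => [|_ [n _ <-]//]; exists (N (u 0%N)), 0%N.
apply: ae_on_sub GE _ => t _ Gt n; rewrite -lee_fin Gt.
by apply: ereal_sup_ubound; exists n.
Qed.

(** The dilate of f^* by 1/t is at least f^*(t) on ]0, 1], so its norm, of order t^(-b) times that
    of f, bounds f^*(t) times the norm of [indic01]. *)
Lemma rearr_le_norm : exists2 C' : R, 0 <= C' & forall f t, Y f -> 0 < t -> t <= 1 ->
  rearr I f t <= C' * t^-1 `^ b * N f.
Proof.
have [Yi Ni] := Y_indic01 hI hY; exists (C / N indic01); first by rewrite divr_ge0// ltW.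
move=> f t Yf t0 t1; have [Yr Nr] := Y_rearr hY Yf.
have it1 : 1 <= t^-1 by rewrite invf_ge1.
have [Yd Nd] := dil_bound it1 Yr.
have [|_ h] := Y_lattice hY Yd (Y_measurable hY (Y_scale hY (rearr I f t) Yi)).
  apply: ae_on_sub (ae_on_gt0 hI) _ => s Is s0.
  rewrite /dil invrK ger0_norm; last by rewrite mulr_ge0// ?rearr_ge0r// /indic01 indicE.
  rewrite ger0_norm ?rearr_ge0r// /indic01 indicE.
  have [s01|_] := boolP (s \in _); last by rewrite mulr0 rearr_ge0r.
  rewrite mulr1; apply: (rearr_noninc hI hY Yf); first exact: mulr_gt0.
  by move: s01; rewrite inE/= in_itv/= => /andP[_ s1]; rewrite ler_piMl// ltW.
move: h; rewrite (Y_normZ hY)// ger0_norm ?rearr_ge0r// => h.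
rewrite -ler_pdivlMr// in h; apply: (le_trans h).
rewrite Nr in Nd; rewrite ler_pdivrMr//; apply: (le_trans Nd).
by rewrite le_eqVlt; apply/orP; left; apply/eqP; field; rewrite gt_eqF.
Qed.

(** Admitting the exponent +oo lets one argument give the embeddings for both the source and the
    target couple. *)
Context (rr : \bar R).
Hypothesis hrr : rr = +oo%E \/ exists2 r : R, 1 <= r & rr = r%:E.

Lemma lorentz_fin f : lorentz I p rr f ->
  (qnorm (lorentz I p rr) f)%:E = lorentz_norm I p rr f.
Proof. by move=> -[mf foo] /=; rewrite fineK// ge0_fin_numE// (lorentz_norm_ge0 hI hp). Qed.

Lemma lorentz_qnorm_ge0 f : 0 <= qnorm (lorentz I p rr) f.
Proof. by rewrite /= fine_ge0// (lorentz_norm_ge0 hI hp). Qed.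

Lemma lorentz_le f w : lmeasurable I f -> (lorentz_norm I p rr f <= w%:E)%E ->
  lorentz I p rr f /\ qnorm (lorentz I p rr) f <= w.
Proof.
move=> mf fw; have foo : (lorentz_norm I p rr f < +oo)%E by apply: le_lt_trans fw _; rewrite ltry.
by split=> //; rewrite -lee_fin lorentz_fin.
Qed.

(** The part of f above the level f^*(t) has a rearrangement that vanishes from t on and is at most
    f^*, which is the situation of [lorentz_dyadic]. *)
Lemma lorentz_top f t w : Y f -> 0 < t ->
  (forall n, \sum_(k < n) (t / 2 ^+ k) `^ a * rearr I f (t / 2 ^+ k.+1) <= w) ->
  lorentz I p rr (top (rearr I f t) f) /\
  qnorm (lorentz I p rr) (top (rearr I f t) f) <= w.
Proof.
move=> Yf t0 fw; have mf := Y_measurable hY Yf.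
apply: lorentz_le; first exact: lmeasurable_top.
have [|||||inf rf] := @lorentz_dyadic _ _ hI _ hp (top (rearr I f t) f) (rearr I f) t w t0.
- move=> s; apply: rearr_top0; first exact: rearr_ge0r.
  by apply: distr_rearr => //; rewrite (rearrE hI hY).
- by move=> s s0; rewrite (rearrE hI hY)//; exact: rearr_top_le.
- by move=> s u s0 su; exact: (rearr_noninc hI hY).
- by move=> s _; exact: rearr_ge0r.
- exact: fw.
by case: hrr => [->|[r r1 ->]]; [exact: inf|exact: rf].
Qed.

(** If both norms are at most M, then f^*(s) <= M * min(1, 4 s^(-a)). The dilation series of the
    indicator of [0, 1] majorises min(1, s^(-a)): for s in ]2^k, 2^(k+1)] its term k equals 2^(-ka)
    >= s^(-a). *)
Lemma embeds_low : embeds (cap_space (lorentz I p rr) (Linfty I)) Y.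
Proof.
have [Yi Ni] := Y_indic01 hI hY.
have [|V [YV NV uV]] := dilation_series Yi; first by move=> t; rewrite /indic01 indicE.
have key f : cap_space (lorentz I p rr) (Linfty I) f ->
    Y f /\ N f <= (5 * N V) * qnorm (cap_space (lorentz I p rr) (Linfty I)) f.
  move=> -[Af Lf]; set M := qnorm (cap_space _ _) f.
  have ML : qnorm (Linfty I) f <= M by rewrite /M/= le_max lexx orbT.
  have MA : qnorm (lorentz I p rr) f <= M by rewrite /M/= le_max lexx.
  have M0 : 0 <= M by apply: le_trans MA; exact: lorentz_qnorm_ge0.
  have [||Yf Nf] := @Y_rearr_le _ _ hI Y hY (fun t => 4 * M * V t) f (Y_scale hY _ YV).
  - by case: Af.
  - apply: ae_on_sub2 (ae_on_gt0 hI) uV _ => s Is s0 uVs.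
    have rM : (rearrangement I f s <= M%:E)%E.
      apply: rearr_le => //; rewrite /distr.
      have /ae_onE : ae_on I (fun t => `|f t| <= M).
        by apply: ae_on_sub (LinftyP Lf) _ => t _ /le_trans; exact.
      rewrite (_ : [set t | ~ `|f t| <= M] = [set x | M < `|f x|]).
        by move=> ->; rewrite lee_fin ltW.
      by apply/seteqP; split=> x /=; rewrite ltNge => /negP.
    have [s2|s2] := lerP s 2.
      apply: (le_trans rM); rewrite lee_fin.
      have := uVs 1%N; rewrite big_ord_recr big_ord0/= add0r /theta expr0 invr1 powR1 mul1r.
      rewrite /indic01 indicE expr1 mem_set/=; last by rewrite in_itv/= divr_ge0 ?(ltW s0)//; lra.
      by move=> V1; nra.
    have [k /andP[ks sk]] : exists k, 2 ^+ k < s <= 2 ^+ k.+1.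
      have ex : exists k, s <= 2 ^+ k by apply: exprn_unbounded; rewrite ltr1n.
      case: (ex_minnP ex) => -[|k] sk kmin; first by move: sk; rewrite expr0; lra.
      by exists k; rewrite sk andbT ltNge; apply/negP => /kmin; rewrite ltnn.
    have sa0 : 0 < s `^ a by rewrite powR_gt0.
    have rA : (rearrangement I f s <= (4 * M / s `^ a)%:E)%E.
      rewrite EFinM muleC lee_pdivlMl//.
      apply: (le_trans (lorentz_lower hI hp f hrr Is s0)).
      by rewrite -lorentz_fin// -EFinM lee_fin ler_pM2l.
    apply: (le_trans rA); rewrite lee_fin ler_wpM2l ?mulr_ge0//.
    apply: le_trans (uVs k.+1); rewrite big_ord_recr/=.
    apply: (@le_trans _ _ (theta k * indic01 (s / 2 ^+ k.+1))); last first.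
      by rewrite lerDr sumr_ge0// => i _; rewrite mulr_ge0// /indic01 indicE.
    rewrite /indic01 indicE mem_set/=; last first.
      rewrite in_itv/= divr_ge0 ?(ltW s0)// ?exprn_ge0//.
      by rewrite ler_pdivrMr ?mul1r// exprn_gt0.
    have p2k : 0 < 2 ^+ k :> R by rewrite exprn_gt0.
    have h : theta k * (2 ^+ k) `^ a = 1.
      by rewrite /theta -powRM ?invr_ge0 ?(ltW p2k)// mulVf ?gt_eqF// powR1.
    rewrite mulr1 -[leLHS]mul1r -h ler_pdivrMr// ler_wpM2l//.
    by rewrite ge0_ler_powR// ?nnegrE ltW.
  split => //; apply: (le_trans Nf); rewrite (Y_normZ hY)// ger0_norm ?mulr_ge0//.
  by have := Y_norm_ge0 hY YV; nra.
split; first by move=> f /key[].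
by exists (5 * N V) => f /key[].
Qed.

Lemma sum_space_le (A : fspace R) f u v : (forall h, 0 <= qnorm A h) ->
  lmeasurable I f -> decomposes I A (Linfty I) f u v ->
  sum_space I A (Linfty I) f /\
  qnorm (sum_space I A (Linfty I)) f <= qnorm A u + qnorm (Linfty I) v.
Proof.
move=> A0 mf fuv; split; first by split=> //; exists u, v.
apply: ge_inf; last by exists u, v.
exists 0 => _ [u' [v' [_ ->]]]; apply: addr_ge0 => //; exact: Linfty_qnorm_ge0.
Qed.

(** Cut f at the level f^*(1). By [rearr_le_norm], the dyadic sum of the top part at t = 1 is a
    geometric series of ratio 2^(b-a). *)
Lemma embeds_up : embeds Y (sum_space I (lorentz I p rr) (Linfty I)).
Proof.
have [C' C'0 hC'] := rearr_le_norm.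
have key f : Y f -> sum_space I (lorentz I p rr) (Linfty I) f /\
    qnorm (sum_space I (lorentz I p rr) (Linfty I)) f <= (C' * S + C') * N f.
  move=> Yf; have mf := Y_measurable hY Yf; have Nf := Y_norm_ge0 hY Yf.
  pose y := rearr I f 1; have y0 : 0 <= y by exact: rearr_ge0r.
  have [|tA tN] := @lorentz_top f 1 (C' * S * N f) Yf ltr01.
    move=> n; apply: (@le_trans _ _ (\sum_(k < n) C' * (theta k * (2 ^+ k.+1) `^ b) * N f)).
      apply: ler_sum => k _; rewrite !div1r -/(theta k).
      have p2 : 1 <= 2 ^+ k.+1 :> R by rewrite exprn_ege1// ler1n.
      have := hC' f (2 ^- k.+1) Yf; rewrite invr_gt0 exprn_gt0// invf_le1 ?exprn_gt0// invrK.
      move=> /(_ isT p2) h; apply: (le_trans (ler_wpM2l (theta_ge0 k) h)).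
      by rewrite !mulrA [theta k * C']mulrC.
    by rewrite -mulr_suml ler_wpM2r// -mulr_sumr ler_wpM2l.
  have [bL bN] : Linfty I (bot y f) /\ qnorm (Linfty I) (bot y f) <= y.
    apply: Linfty_bounded => //; first exact: lmeasurable_bot.
    by apply: ae_on_all => t _; exact: bot_le.
  have := hC' f 1 Yf ltr01 (lexx _); rewrite invr1 powR1 mulr1 -/y => yN.
  have [|||fS fN] := @sum_space_le (lorentz I p rr) f (top y f) (bot y f).
  - exact: lorentz_qnorm_ge0.
  - exact: mf.
  - by split => //; apply: ae_on_all => t _; exact: top_bot.
  split => //; apply: (le_trans fN); rewrite mulrDl; apply: lerD => //.
  exact: le_trans yN.
split; first by move=> f /key[].
by exists (C' * S + C') => f /key[].
Qed.

Lemma zero_Linfty : Linfty I (fun=> 0).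
Proof.
have [|//] := @Linfty_bounded _ I (fun=> 0) 0 (lmeasurable_cst 0) (lexx _).
by apply: ae_on_all => t _; rewrite normr0.
Qed.

Lemma zero_lorentz : lorentz I p rr (fun=> 0).
Proof.
have [|||||inf rf] := @lorentz_dyadic _ _ hI _ hp (fun=> 0) (fun=> 0) 1 0 ltr01.
- move=> s s1; apply/eqP; rewrite eq_le rearr_ge0 andbT; apply: rearr_le => //.
  rewrite /distr (_ : I `&` _ = set0) ?measure0 ?lee_fin; first by lra.
  by apply/seteqP; split=> // x /= [_]; rewrite normr0 ltxx.
- move=> s s0; apply: rearr_le => //.
  rewrite /distr (_ : I `&` _ = set0) ?measure0 ?lee_fin; first by lra.
  by apply/seteqP; split=> // x /= [_]; rewrite normr0 ltxx.
- by [].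
- by [].
- by move=> n; rewrite big1// => k _; rewrite mulr0.
apply: (@lorentz_le _ 0 _ _).1; first exact: lmeasurable_cst.
by case: hrr => [->|[r r1 ->]]; [exact: inf|exact: rf].
Qed.

Lemma bounded_on_Y T :
  linear_operator I (sum_space I (lorentz I p rr) (Linfty I))
    (sum_space I (lorentz I p +oo%E) (Linfty I)) T ->
  bounded_operator (lorentz I p rr) (lorentz I p +oo%E) T ->
  bounded_operator (Linfty I) (Linfty I) T ->
  bounded_operator Y Y T.
Proof.
move=> lin [c0 h0] [c1 h1].
(* Absolute values, because the constants in [bounded_operator] may be negative. *)
exists (`|c0| * (C * S) + `|c1|) => f Yf.
have [Yr Nr] := Y_rearr hY Yf; have mf := Y_measurable hY Yf.
have [|G [YG NG uG]] := dilation_series Yr; first by move=> t; exact: rearr_ge0r.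
have sf : sum_space I (lorentz I p rr) (Linfty I) f by apply: embeds_up.1.
have [mT _] := lo_mem lin sf.
have YG1 := Y_scale hY `|c0| YG; have Yr1 := Y_scale hY `|c1| Yr.
have [|YT NT] := Y_rearr_le hI hY (Y_add hY YG1 Yr1) mT; last first.
  split => //; apply: (le_trans NT); apply: (le_trans (Y_normD hY YG1 Yr1)).
  rewrite !(Y_normZ hY)// !normr_id Nr mulrDl lerD2r -mulrA ler_wpM2l//.
  by rewrite -Nr.
apply: ae_on_sub2 (ae_on_gt0 hI) uG _ => t It t0 Gt.
set y := rearr I f t.
have y0 : 0 <= y by exact: rearr_ge0r.
have G0 : 0 <= G t by have := Gt 0%N; rewrite big_ord0.
have ta0 : 0 < t `^ a by rewrite powR_gt0.
(* The dyadic sum at t is t^a times a partial sum of the dilation series of f^* at t, since (t /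
   2^k)^a = t^a * theta k. *)
have [|tA tN] := @lorentz_top f t (t `^ a * G t) Yf t0.
  move=> n; apply: le_trans (ler_wpM2l (ltW ta0) (Gt n)).
  rewrite mulr_sumr; apply: ler_sum => k _.
  by rewrite powRM ?(ltW t0) ?invr_ge0 ?exprn_ge0// mulrA.
have [bL bN] : Linfty I (bot y f) /\ qnorm (Linfty I) (bot y f) <= y.
  apply: Linfty_bounded => //; first exact: lmeasurable_bot.
  by apply: ae_on_all => s _; exact: bot_le.
have [TtA TtN] := h0 _ tA; have [TbL TbN] := h1 _ bL.
have stop : sum_space I (lorentz I p rr) (Linfty I) (top y f).
  split; first by case: tA.
  exists (top y f), (fun=> 0); split => //; first exact: zero_Linfty.
  by apply: ae_on_all => s _; rewrite addr0.
have sbot : sum_space I (lorentz I p rr) (Linfty I) (bot y f).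
  split; first by case: bL.
  exists (fun=> 0), (bot y f); split; [exact: zero_lorentz|exact: bL|].
  by apply: ae_on_all => s _; rewrite add0r.
(* The cut depends on t, and so does the null set where additivity fails. This is harmless: only the
   rearrangement at this single t is being estimated. *)
have := lo_linear lin 1 stop sbot.
rewrite (_ : (fun s => 1 * top y f s + bot y f s) = f); last first.
  by apply/funext => s; rewrite mul1r -top_bot.
move=> Tlin.
have {}Tlin : ae_on I (fun s => T f s = T (top y f) s + T (bot y f) s).
  by apply: ae_on_sub Tlin _ => s _ ->; rewrite mul1r.
have Tb : ae_on I (fun s => `|T (bot y f) s| <= `|c1| * y).
  apply: ae_on_sub (LinftyP TbL) _ => s _ /le_trans; apply.
  apply: (le_trans TbN); apply: (@le_trans _ _ (`|c1| * qnorm (Linfty I) (bot y f))).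
    by rewrite ler_wpM2r ?Linfty_qnorm_ge0// ler_norm.
  by rewrite ler_wpM2l.
have c1y : 0 <= `|c1| * y by rewrite mulr_ge0.
apply: (le_trans (rearr_add_bounded t c1y Tlin Tb)).
rewrite EFinD leeD2r//.
suff : ((t `^ a)%:E * rearrangement I (T (top y f)) t <= (t `^ a * (`|c0| * G t))%:E)%E.
  by rewrite EFinM lee_pmul2l// lte_fin.
apply: (@le_trans _ _ (lorentz_norm I p +oo%E (T (top y f)))).
  by apply: ereal_sup_ubound; exists t.
have -> : lorentz_norm I p +oo%E (T (top y f)) =
    (qnorm (lorentz I p +oo%E) (T (top y f)))%:E.
  case: TtA => _ foo; rewrite fineK// ge0_fin_numE//.
  exact: (lorentz_norm_ge0 hI hp +oo%E).
rewrite lee_fin; apply: (le_trans TtN).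
apply: (@le_trans _ _ (`|c0| * qnorm (lorentz I p rr) (top y f))).
  by rewrite ler_wpM2r ?lorentz_qnorm_ge0// ler_norm.
by rewrite mulrCA ler_wpM2l.
Qed.

End interpolation_from_boyd_index.

Section LI_from_boyd_index.
Context {R : realType} (I : set R).
Hypothesis hI : I = `[0, 1]%classic \/ I = `[0, +oo[%classic.
Context (Y : fspace R) (hY : banach_ri I Y) (p : R) (hp : 1 <= p).

Lemma LI_of_boyd_index_lt r : 1 <= r -> upper_boyd_index I Y < p^-1 ->
  LI I (lorentz I p r%:E) (lorentz I p +oo%E) Y.
Proof.
move=> r1 /(upper_boyd_index_bound hI hY)[b [C [b0 ba C0 dilb]]].
have hr : r%:E = +oo%E \/ exists2 r' : R, 1 <= r' & r%:E = r'%:E by right; exists r.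
have hinf : +oo%E = +oo%E :> \bar R \/ exists2 r' : R, 1 <= r' & +oo%E = r'%:E :> \bar R by left.
have qY : quasi_banach_ri I Y by case: hY => qY cY rY _; split => //; exists 1.
split => //.
- exact: (embeds_low hI hY hp b0 ba C0 dilb hr).
- exact: (embeds_up hI hY hp ba C0 dilb hr).
- exact: (embeds_low hI hY hp b0 ba C0 dilb hinf).
- exact: (embeds_up hI hY hp ba C0 dilb hinf).
- exact: (bounded_on_Y hI hY hp ba C0 dilb hr).
Qed.

End LI_from_boyd_index.

(** * Sums of dilations *)

Section real_sequences.
Context {R : realType}.

Lemma exprS_sub_le (x : R) j : 0 <= x ->
  (x + 1) ^+ j.+1 - x ^+ j.+1 <= j.+1%:R * (x + 1) ^+ j.
Proof.
move=> x0; elim: j => [|j IH]; first by rewrite !expr1 expr0; lra.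
have h : x ^+ j.+1 <= (x + 1) ^+ j.+1 by apply: lerXn2r; rewrite ?nnegrE; lra.
have x1 : 0 <= x + 1 by lra.
have := ler_wpM2l x1 IH.
rewrite -[j.+2%:R]natr1 [(x + 1) ^+ j.+2]exprS [x ^+ j.+2]exprS.
set X := (x + 1) ^+ j.+1 in h *; set Z := x ^+ j.+1 in h *.
have -> : (x + 1) * (j.+1%:R * (x + 1) ^+ j) = j.+1%:R * X by rewrite /X exprS; ring.
nra.
Qed.

(** Telescoping the mean value bound of [exprS_sub_le]; the terms are listed in decreasing order to
    match the convolution in [iter_dsum_ge]. *)
Lemma sum_exprn_ge m j :
  m.+1%:R ^+ j.+1 <= j.+1%:R * \sum_(i < m.+1) (m - i).+1%:R ^+ j :> R.
Proof.
elim: m => [|m IH]; first by rewrite big_ord_recl big_ord0 subnn/= !expr1n addr0 mulr1 ler1n.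
rewrite big_ord_recl subn0 mulrDr.
under eq_bigr do rewrite lift0 subSS.
have := @exprS_sub_le m.+1%:R j (ler0n _ _).
rewrite natr1; lra.
Qed.

(** With ratio at least 2, a geometric sum is at most twice its largest term. This controls the
    overlap of the level sets in [lorentz_layers]. *)
Lemma sum_geometric_below (b s y : R) n : 2 <= b -> 0 < s -> 0 <= y ->
  \sum_(k < n) (if b ^+ k * s <= y then b ^+ k * s else 0) <= 2 * y.
Proof.
move=> b2 s0 y0.
have b0 : 0 < b by lra.
have geo m : \sum_(k < m) b ^+ k <= b ^+ m.
  elim: m => [|m IH]; first by rewrite big_ord0 expr0.
  rewrite big_ord_recr/= exprS.
  have := exprn_gt0 m b0; nra.
elim: n => [|n IH]; first by rewrite big_ord0 mulr_ge0.
rewrite big_ord_recr/=; case: ifPn => [h|_]; last by rewrite addr0.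
apply: (@le_trans _ _ (2 * (b ^+ n * s))); last by rewrite ler_pM2l.
rewrite mulr2n mulrDl !mul1r lerD2r.
apply: (@le_trans _ _ (\sum_(k < n) b ^+ k * s)).
  apply: ler_sum => k _; case: ifP => // _.
  by rewrite mulr_ge0 ?exprn_ge0// ltW.
by rewrite -mulr_suml ler_pM2r// geo.
Qed.

(** A dyadic layer cake: the first threshold lam / 2^m below y satisfies y <= 2 * lam / 2^m, and if
    there is none with m <= n then y <= lam / 2^n. Only indicators of level sets appear, which suits
    functions that are not integrable. *)
Lemma dyadic_layers (y lam : R) n : 0 <= y -> y <= lam ->
  y <= lam / 2 ^+ n + lam * \sum_(m < n.+1) 2 / 2 ^+ m * (lam / 2 ^+ m < y)%R%:R.
Proof.
move=> y0 ylam; have lam0 : 0 <= lam by lra.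
elim: n => [|n IH].
  by rewrite expr0 divr1 big_ord_recl big_ord0 addr0 (le_trans ylam)// lerDl !mulr_ge0// invr_ge0.
rewrite big_ord_recr/=; set X := \sum_(m < n.+1) _ in IH *.
have X0 : 0 <= X by apply: sumr_ge0 => m _; rewrite mulr_ge0// divr_ge0// exprn_ge0.
case: (ltrP (lam / 2 ^+ n.+1) y) => h.
  apply: (le_trans IH); rewrite mulr1 exprS invfM.
  have -> : 2 * (2^-1 / 2 ^+ n) = (2 ^+ n)^-1 :> R by rewrite mulrA mulfV ?mul1r.
  rewrite mulrDr addrA addrAC lerD2r.
  by rewrite lerDr !mulr_ge0// invr_ge0 exprn_ge0.
rewrite mulr0 addr0; apply: (le_trans h); rewrite lerDl mulr_ge0//.
Qed.

(** Split at eta = L^(-1/(r+p)). Terms up to eta contribute at most L * eta^p; the others are at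
    most 1 and, by Chebyshev, at most eta^(-r) in number. This eta makes both bounds equal to
    L^(r/(r+p)), which is where the exponent d = 1/(r+p) originates. *)
Lemma sum_powR_le (x : nat -> R) (p r : R) L : 0 < p -> 0 < r ->
  (forall k, 0 <= x k) -> \sum_(k < L) x k `^ r <= 1 ->
  \sum_(k < L) x k `^ p <= 2 * L%:R `^ (r / (r + p)).
Proof.
move=> p0 r0 x0 xr.
have [->|L0] := posnP L.
  by rewrite big_ord0 mulr_ge0// powR_ge0.
have LR : 0 < L%:R :> R by rewrite ltr0n.
have one s : 1 `^ s = 1 :> R by rewrite powR1.
pose eta := L%:R `^ (- (r + p)^-1).
have rp : 0 < r + p by lra.
have eta0 : 0 < eta by rewrite powR_gt0.
have x1 k : (k < L)%N -> x k <= 1.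
  move=> kL; rewrite leNgt; apply/negP => xk1.
  suff : 1 < x k `^ r.
    apply/negP; rewrite -leNgt; apply: le_trans xr.
    rewrite (bigD1 (Ordinal kL))//= lerDl; apply: sumr_ge0 => i _; exact: powR_ge0.
  by rewrite -[ltLHS](one r) gt0_ltr_powR// nnegrE.
have bnd k : (k < L)%N -> x k `^ p <= eta `^ p + eta `^ (- r) * x k `^ r.
  move=> kL; have [xe|xe] := lerP (x k) eta.
    rewrite -[leLHS]addr0 lerD ?mulr_ge0 ?powR_ge0//.
    by rewrite ge0_ler_powR ?nnegrE// ltW.
  have h : 1 <= eta `^ (- r) * x k `^ r.
    rewrite powRN mulrC ler_pdivlMr ?powR_gt0// mul1r.
    by rewrite ge0_ler_powR ?nnegrE// ltW.
  apply: (@le_trans _ _ 1); last by rewrite (le_trans h)// lerDr powR_ge0.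
  by rewrite -[leRHS](one p) ge0_ler_powR ?nnegrE ?x1// ltW.
apply: (@le_trans _ _ (\sum_(k < L) (eta `^ p + eta `^ (- r) * x k `^ r))).
  by apply: ler_sum => k _; exact: bnd.
rewrite big_split/= sumr_const card_ord -mulr_sumr.
have E1 : eta `^ p * L%:R = L%:R `^ (r / (r + p)).
  rewrite /eta -powRrM -[X in _ * X]powRr1// -powRD ?(gt_eqF LR) ?implybT//.
  by congr (_ `^ _); field; rewrite gt_eqF.
have E2 : eta `^ (- r) = L%:R `^ (r / (r + p)).
  by rewrite /eta -powRrM; congr (_ `^ _); field; rewrite gt_eqF.
rewrite -[_ *+ L]mulr_natr E1 E2 [2]mulr2n mulrDl !mul1r lerD2l.
by rewrite ler_piMr ?powR_ge0.
Qed.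

(** Later absorbs the logarithmic factor n + 1 into geometric decay. *)
Lemma natr_exprn_le (x : R) n : 0 <= x -> x < 1 -> n.+1%:R * x ^+ n <= (1 - x)^-1.
Proof.
move=> x0 x1; apply: le_trans (geometric_sum_le n.+1 x0 x1).
rewrite mulr_natl -[X in _ *+ X]card_ord -sumr_const; apply: ler_sum => k _.
by apply: ler_wiXn2l => //; [exact: ltW|rewrite -ltnS].
Qed.

End real_sequences.

(** * Chebyshev's inequality for weighted families of sets *)

Section chebyshev.
Context {R : realType} (I : set R).
Hypothesis mI : measurable (I : set (leb R)).

Lemma lebm_weighted_sum (J : finType) (w : J -> R) (E : J -> set (leb R)) :
  (forall j, 0 <= w j) -> (forall j, measurable (E j)) -> (forall j, E j `<=` I) ->
  (lebm (I `&` [set t | 1 < \sum_j w j * \1_(E j) t]%R) <=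
   \sum_j (w j)%:E * lebm (E j))%E.
Proof.
move=> w0 mE EI.
pose g : leb R -> R := fun t => \sum_j w j * \1_(E j) t.
have mg : measurable_fun (I : set (leb R)) g.
  apply: measurable_sum => j; apply: measurable_funM; first exact: measurable_cst.
  exact: measurable_indic.
have g0 t : 0 <= g t by apply: sumr_ge0 => j _; rewrite mulr_ge0.
pose B : set (leb R) := I `&` [set t | 1 < g t].
have mB : measurable B.
  have := mg mI `]1, +oo[%classic (measurable_itv _).
  by congr (measurable (_ `&` _)); apply/seteqP; split=> x /=; rewrite in_itv/= andbT.
apply: (@le_trans _ _ (\int[@lebm R]_(t in (I : set (leb R))) (g t)%:E)%E).
  have mind : measurable_fun (I : set (leb R)) (fun t : leb R => (\1_B t : R)%:E).
    by apply/measurable_EFinP; exact: measurable_indic.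
  have <- : (\int[@lebm R]_(t in (I : set (leb R))) (\1_B t : R)%:E = lebm B)%E.
    rewrite (@integral_indic _ _ _ (@lebm R) _ mI _ mB); congr lebm.
    by apply/seteqP; split=> [t []|t Bt]//; split => //; case: Bt.
  apply: (@ge0_le_integral _ _ _ (@lebm R) _ mI).
  - by move=> t _; rewrite lee_fin.
  - exact: mind.
  - exact/measurable_EFinP.
  move=> t _; rewrite lee_fin indicE; have [tB|_] := boolP (t \in B) => //.
  by rewrite ltW//; move: tB; rewrite inE => -[].
have mwj j : measurable_fun (I : set (leb R)) (fun t : leb R => (\1_(E j) t : R)%:E).
  by apply/measurable_EFinP; exact: measurable_indic.
rewrite (_ : (fun t => (g t)%:E) = (fun t => \sum_j (w j)%:E * (\1_(E j) t : R)%:E)%E); last first.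
  by apply/funext => t; rewrite /g -sumEFin.
rewrite (@ge0_integral_sum _ _ _ (@lebm R) _ mI); last 2 first.
- move=> j; apply: emeasurable_funM; [exact: measurable_cst|exact: mwj].
- by move=> j t _; rewrite mule_ge0 ?lee_fin.
apply: lee_sum => j _.
rewrite (@ge0_integralZl _ _ _ (@lebm R) _ mI _ (mwj j)); last 2 first.
- by move=> t _; rewrite lee_fin.
- by rewrite lee_fin.
rewrite (@integral_indic _ _ _ (@lebm R) _ mI _ (mE j)).
rewrite (_ : E j `&` I = E j)//.
by apply/seteqP; split=> [t []|t Et]//; split => //; exact: (EI j t Et).
Qed.

End chebyshev.

(** * The Lorentz norm in terms of level sets *)

Section lorentz_layers.
Context {R : realType} (I : set R).
Hypothesis hI : I = `[0, 1]%classic \/ I = `[0, +oo[%classic.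
Context (p r : R) (hp : 1 <= p) (hr : 1 <= r).
Local Notation a := (p^-1).

Let mI := I_measurable hI.
Let p0 : 0 < p. Proof. exact: lt_le_trans hp. Qed.
Let r0 : 0 < r. Proof. exact: lt_le_trans hr. Qed.
Let a0 : 0 < a. Proof. by rewrite invr_gt0. Qed.

Lemma I_lebm_lt s z : 0 <= s -> s < z -> (z%:E <= lebm I)%E -> I s.
Proof.
move=> s0 sz; case: hI => ->; rewrite lebm_itv/= ?lte_fin ?ltr01 ?ltry ?oppr0 ?adde0 ?lee_fin in_itv/= s0//.
by move=> z1 /=; apply: ltW; exact: lt_le_trans z1.
Qed.

Lemma two_powR_ge2 : 2 <= 2 `^ r :> R.
Proof. by rewrite -[leLHS]powRr1// ler_powR// ler1n. Qed.

(** On [m k / 2, m k[ one has f^* >= 2^k * sigma, and at a given t the levels below f^*(t) form a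
    geometric progression. In the constant 8, a factor 2 pays for this overlap and 4 for the halved
    intervals. The m k are finite lower bounds because the distribution function is not yet known to
    be finite. *)
Lemma lorentz_layers f D sigma n (m : nat -> R) : 0 <= D -> 0 < sigma ->
  (lorentz_norm I p r%:E f <= D%:E)%E ->
  (forall k, 0 <= m k) -> (forall k, ((m k)%:E <= distr I f (2 ^+ k * sigma)%R)%E) ->
  \sum_(k < n) (2 ^+ k * sigma * m k `^ a) `^ r <= (8 * D) `^ r.
Proof.
move=> D0 sigma0 fD m0 md.
pose J k : set (leb R) := `[(m k / 2), (m k)[%classic.
have mJ k : measurable (J k) by exact: leb_measurable_itv.
have JI k : J k `<=` I.
  move=> s; rewrite /J/= in_itv/= => /andP[ms sm].
  apply: (I_lebm_lt _ sm); first by apply: le_trans ms; rewrite divr_ge0.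
  by apply: (le_trans (md k)); apply: le_lebm => x [].
have lenJ k : lebm (J k) = (m k / 2)%:E.
  rewrite lebm_itv/= lte_fin; case: ltrP => h; first by rewrite -EFinB; congr _%:E; lra.
  by congr _%:E; have := m0 k; lra.
pose c k := (2 ^+ k * sigma) `^ r * ((m k / 2) `^ a) `^ r / m k.
have c0 k : 0 <= c k by rewrite divr_ge0 ?mulr_ge0 ?powR_ge0.
have mind k : measurable_fun (I : set (leb R)) (fun z : leb R => (\1_(J k) z : R)%:E).
  by apply/measurable_EFinP; exact: measurable_indic.
have mint := @measurable_lorentz_integrand R I p r f _ mI.
have int0 t : I t -> (0 <= lorentz_integrand I p r f t)%E by exact: (lorentz_integrand_ge0 hI).
have pw (t : R) : I t ->
    (\sum_(k < n) ((c k)%:E * (\1_(J k) t : R)%:E) <= 2%:E * lorentz_integrand I p r f t)%E.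
  move=> It; have := I_ge0 hI It; rewrite le_eqVlt => /orP[/eqP t0|t0].
    rewrite big1 => [|k _]; first by apply: mule_ge0; [rewrite lee_fin|exact: int0].
    rewrite indicE memNset ?mule0// /J/= in_itv/= -t0 => /andP[h1 h2].
    by have := m0 k; lra.
  have := rearr_ge0 I f t; rewrite /lorentz_integrand.
  have tar : 0 < (t `^ a) `^ r by rewrite powR_gt0// powR_gt0.
  have jump k : t < m k -> ((2 ^+ k * sigma)%:E <= rearrangement I f t)%E.
    by move=> tm; apply: rearr_ge; apply: lt_le_trans (md k); rewrite lte_fin.
  case: (rearrangement I f t) jump => [y| |] jump; last by rewrite leeNy_eq.
    rewrite lee_fin => y0.
    rewrite -[((t `^ a)%:E * y%:E)%E]EFinM poweR_EFin -[(_ * (t^-1)%:E)%E]EFinM.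
    rewrite -[leRHS]EFinM.
    under eq_bigr do rewrite -EFinM.
    rewrite sumEFin lee_fin.
    apply: (@le_trans _ _ (\sum_(k < n) (t `^ a) `^ r / t *
        (if (2 `^ r) ^+ k * sigma `^ r <= y `^ r then (2 `^ r) ^+ k * sigma `^ r else 0))).
      apply: ler_sum => k _; rewrite indicE.
      have [tJ|_] := boolP (t \in J k); last first.
        by rewrite mulr0 mulr_ge0 ?divr_ge0 ?(ltW tar) ?(ltW t0)//; case: ifP => // _; rewrite mulr_ge0 ?exprn_ge0 ?powR_ge0.
      move: tJ; rewrite inE /J/= in_itv/= => /andP[mt tm].
      have := jump k tm; rewrite lee_fin => ky.
      have E : (2 ^+ k * sigma) `^ r = (2 `^ r) ^+ k * sigma `^ r.
        by rewrite powRM ?exprn_ge0 ?(ltW sigma0)// exprn_powR.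
      rewrite -E ge0_ler_powR ?nnegrE ?(ltW r0)//; last by rewrite mulr_ge0 ?exprn_ge0// ltW.
      rewrite mulr1 /c -mulrA [leLHS]mulrC ler_wpM2r ?powR_ge0//.
      have mk0 : 0 < m k by apply: lt_trans tm.
      have le1 : (m k / 2) `^ a <= t `^ a.
        by rewrite ge0_ler_powR ?nnegrE ?divr_ge0 ?(ltW a0) ?(ltW t0).
      have le2 : ((m k / 2) `^ a) `^ r <= (t `^ a) `^ r.
        by rewrite ge0_ler_powR ?nnegrE ?powR_ge0 ?(ltW r0).
      have le3 : (m k)^-1 <= t^-1 by rewrite lef_pV2 ?posrE// ltW.
      have mki : 0 <= (m k)^-1 by rewrite invr_ge0 ltW.
      exact: (ler_pM (powR_ge0 _ _) mki le2 le3).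
    rewrite -mulr_sumr; apply: (@le_trans _ _ ((t `^ a) `^ r / t * (2 * y `^ r))).
      rewrite ler_wpM2l ?divr_ge0 ?(ltW tar) ?(ltW t0)// sum_geometric_below ?powR_ge0 ?powR_gt0//.
      exact: two_powR_ge2.
    by rewrite powRM ?powR_ge0//; lra.
  move=> _; rewrite mulry gtr0_sg ?powR_gt0// mul1e poweRyr ?gt_eqF// mulyr gtr0_sg ?invr_gt0// mul1e.
  by rewrite mulry gtr0_sg// mul1e leey.
have key : (\sum_(k < n) (c k)%:E * (m k / 2)%:E <=
    2%:E * \int[@lebm R]_(t in (I : set (leb R))) lorentz_integrand I p r f t)%E.
  rewrite -(@ge0_integralZl _ _ _ (@lebm R) _ mI _ mint _ int0); last by rewrite lee_fin.
  have -> : (\sum_(k < n) (c k)%:E * (m k / 2)%:E =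
     \int[@lebm R]_(t in (I : set (leb R))) \sum_(k < n) ((c k)%:E * (\1_(J k) t : R)%:E))%E.
    rewrite (@ge0_integral_sum _ _ _ (@lebm R) _ mI); last 2 first.
    - move=> j; apply: emeasurable_funM; [exact: measurable_cst|exact: mind].
    - by move=> j t _; rewrite mule_ge0 ?lee_fin.
    apply: eq_bigr => k _.
    rewrite (@ge0_integralZl _ _ _ (@lebm R) _ mI _ (mind k)); last 2 first.
    - by move=> t _; rewrite lee_fin.
    - by rewrite lee_fin.
    rewrite (@integral_indic _ _ _ (@lebm R) _ mI _ (mJ k)) -lenJ; congr (_ * lebm _)%E.
    by apply/seteqP; split=> [t Jt|t []//]; split => //; exact: (JI k t Jt).
  apply: (@ge0_le_integral _ _ _ (@lebm R) _ mI).
  - by move=> t _; apply: sume_ge0 => k _; rewrite mule_ge0 ?lee_fin.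
  - apply: emeasurable_sum => k; apply: emeasurable_funM; [exact: measurable_cst|exact: mind].
  - apply: emeasurable_funM; [exact: measurable_cst|exact: mint].
  by move=> t It; exact: pw.
have intD : (\int[@lebm R]_(t in (I : set (leb R))) lorentz_integrand I p r f t <= (D `^ r)%:E)%E.
  have X0 : (0 <= \int[@lebm R]_(t in (I : set (leb R))) lorentz_integrand I p r f t)%E.
    by apply: integral_ge0 => t; exact: (lorentz_integrand_ge0 hI).
  move: fD; rewrite lorentz_normE; set X := (\int[_]_(_ in _) _)%E in X0 *.
  move=> XD; have := @gt0_ler_poweR R r _ _ _ _ _ XD.
  rewrite -poweRrM mulVf ?gt_eqF// poweRe1// poweR_EFin.
  by apply; rewrite ?(ltW r0)// in_itv/= leey andbT ?poweR_ge0// lee_fin.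
have {key} : (\sum_(k < n) (c k)%:E * (m k / 2)%:E <= (2 * D `^ r)%:E)%E.
  by apply: (le_trans key); rewrite EFinM lee_wpmul2l// lee_fin.
under eq_bigr do rewrite -EFinM.
rewrite sumEFin lee_fin => key.
have cE k : (2 ^+ k * sigma * m k `^ a) `^ r <= 4 `^ r * (c k * (m k / 2)).
  have [mk0|mk0] := eqVneq (m k) 0.
    rewrite mk0 powR0 ?gt_eqF// mulr0 powR0 ?gt_eqF// mulr_ge0 ?powR_ge0//.
    by rewrite mul0r mulr0.
  have {}mk0 : 0 < m k by rewrite lt_neqAle eq_sym mk0 m0.
  have -> : c k * (m k / 2) = (2 ^+ k * sigma) `^ r * ((m k / 2) `^ a) `^ r / 2.
    by rewrite /c; field; rewrite gt_eqF.
  rewrite [in leRHS]powRM ?invr_ge0 ?(ltW mk0)//.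
  rewrite powRM ?powR_ge0 ?mulr_ge0 ?exprn_ge0 ?(ltW sigma0)//.
  rewrite [leLHS]powRM ?powR_ge0 ?mulr_ge0 ?exprn_ge0 ?(ltW sigma0)//.
  have h1 : 2^-1 <= 2^-1 `^ a :> R by rewrite half_powR_ge ?invf_le1// ltW.
  have h2 : (2^-1) `^ r <= (2^-1 `^ a) `^ r :> R by rewrite ge0_ler_powR ?nnegrE ?powR_ge0// ?invr_ge0 ltW.
  have h3 : 4 `^ r * 2^-1 `^ r = 2 `^ r :> R.
    by rewrite -powRM ?invr_ge0//; congr (_ `^ _); lra.
  have h4 := two_powR_ge2.
  have h5 : 2 <= 4 `^ r * (2^-1 `^ a) `^ r :> R.
    by apply: (le_trans h4); rewrite -h3 ler_wpM2l ?powR_ge0.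
  set A := (2 ^+ k * sigma) `^ r; set B := (m k `^ a) `^ r.
  set F := (2^-1 `^ a) `^ r in h5 *.
  have AB : 0 <= A * B by rewrite mulr_ge0 ?powR_ge0.
  have -> : 4 `^ r * (A * (B * F) / 2) = A * B * (4 `^ r * F / 2) by ring.
  by rewrite ler_peMr//; lra.
apply: (@le_trans _ _ (\sum_(k < n) 4 `^ r * (c k * (m k / 2)))).
  by apply: ler_sum => k _; exact: cE.
rewrite -mulr_sumr; apply: (@le_trans _ _ (4 `^ r * (2 * D `^ r))).
  by rewrite ler_wpM2l ?powR_ge0.
have -> : 8 * D = 4 * (2 * D) by ring.
rewrite powRM ?mulr_ge0// ler_wpM2l ?powR_ge0// powRM// ler_wpM2r ?powR_ge0//.
exact: two_powR_ge2.
Qed.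

Lemma distr_lorentz_fin f D y : 0 <= D -> 0 < y -> (lorentz_norm I p r%:E f <= D%:E)%E ->
  distr I f y \is a fin_num.
Proof.
move=> D0 y0 fD; rewrite ge0_fin_numE ?lebm_ge0// ltey; apply/negP => /eqP foo.
(* With this M the layer at height y alone would exceed the bound: y * M^a = 8 * D + 1. *)
pose M := ((8 * D + 1) / y) `^ p.
have := @lorentz_layers f D y 1 (fun k => if k == 0%N then M else 0) D0 y0 fD.
rewrite big_ord1/= expr0 mul1r => h.
have {}h : (y * M `^ a) `^ r <= (8 * D) `^ r.
  apply: h => -[|k]//=; rewrite ?powR_ge0// ?lebm_ge0//.
  by rewrite expr0 mul1r foo leey.
have My : M `^ a = (8 * D + 1) / y.
  rewrite /M -powRrM divff ?gt_eqF// powRr1// divr_ge0 ?(ltW y0)//; lra.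
move: h; rewrite My mulrCA mulfV ?gt_eqF// mulr1.
apply/negP; rewrite -ltNge gt0_ltr_powR ?nnegrE//; lra.
Qed.

End lorentz_layers.

(** * Weak-type estimates for sums of dilations *)

Section dilation_sums.
Context {R : realType} (I : set R).
Hypothesis hI : I = `[0, 1]%classic \/ I = `[0, +oo[%classic.
Context (p r : R) (hp : 1 <= p) (hr : 1 <= r).
Local Notation a := (p^-1).
Implicit Types (f g : R -> R).

Let mI := I_measurable hI.
Let p0 : 0 < p. Proof. exact: lt_le_trans hp. Qed.
Let r0 : 0 < r. Proof. exact: lt_le_trans hr. Qed.
Let a0 : 0 < a. Proof. by rewrite invr_gt0. Qed.

(** Dilation by 2^p multiplies the norm of L^(p,oo) on the half-line by (2^p)^(1/p) = 2; the weights
    2^(-k) in [dsum] compensate exactly. *)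
Definition base : R := 2 `^ p.
Local Notation q := base.

Lemma base_ge1 k : 1 <= q ^+ k.
Proof.
by apply: exprn_ege1; rewrite /base -[leLHS](powRr0 2) ler_powR ?ler1n// ltW.
Qed.


Definition absf f : R -> R := fun s => `|f s|.

Definition dsum n f (t : R) : R := \sum_(k < 2 ^ n) 2 ^- k * f (t / q ^+ k).

Lemma dsum_ge0 n f t : (forall s, 0 <= f s) -> 0 <= dsum n f t.
Proof. by move=> f0; apply: sumr_ge0 => k _; rewrite mulr_ge0 ?invr_ge0 ?exprn_ge0. Qed.

Lemma dsum_abs_ge0 n f t : 0 <= dsum n (absf f) t.
Proof. by apply: dsum_ge0 => s; exact: normr_ge0. Qed.

Lemma lmeasurable_sum n (F : nat -> R -> R) : (forall k, lmeasurable I (F k)) ->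
  lmeasurable I (fun t => \sum_(k < n) F k t).
Proof.
move=> mF; elim: n => [|n IH].
  by under eq_fun do rewrite big_ord0; exact: lmeasurable_cst.
by under eq_fun do rewrite big_ord_recr; exact: lmeasurableD.
Qed.

Lemma lmeasurable_dsum n f : lmeasurable I f -> lmeasurable I (dsum n f).
Proof.
move=> mf; apply: (@lmeasurable_sum _ (fun k t => 2 ^- k * f (t / q ^+ k))) => k.
by apply: lmeasurableZ; apply: (lmeasurable_div hI) => //; exact: base_ge1.
Qed.

(** Apply [dyadic_layers] to each term. Where the weighted sum of layers is at most 1, the 2^n
    remainders lam / 2^n add up to lam and the layers contribute at most lam; elsewhere Chebyshev
    applies. This is why the number of halvings is tied to the number 2^n of terms. *)
Lemma distr_dsum_layers f lam n : lmeasurable I f -> 0 < lam ->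
  (distr I (dsum n (absf f)) (2 * lam)%R <=
   \sum_(j : 'I_(2 ^ n) * 'I_n.+1) (2 / 2 ^+ j.2)%R%:E *
     ((q ^+ j.1)%:E * distr I f (2 ^+ j.1 * (lam / 2 ^+ j.2))%R))%E.
Proof.
move=> mf lam0.
pose w (j : 'I_(2 ^ n) * 'I_n.+1) : R := 2 / 2 ^+ j.2.
pose E (j : 'I_(2 ^ n) * 'I_n.+1) : set (leb R) :=
  I `&` [set t | 2 ^+ j.1 * (lam / 2 ^+ j.2) < `|dil (q ^+ j.1) f t|].
have w0 j : 0 <= w j by rewrite divr_ge0 ?exprn_ge0.
have mE j : measurable (E j).
  by apply: lmeasurable_lt => //; apply: (lmeasurable_div hI) => //; exact: base_ge1.
have EI j : E j `<=` I by move=> t [].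
apply: (@le_trans _ _ (\sum_j (w j)%:E * lebm (E j))%E); last first.
  apply: lee_sum => j _; rewrite lee_wpmul2l ?lee_fin//.
  exact: (distr_div hI _ _ (base_ge1 _)).
apply: le_trans (lebm_weighted_sum mI w0 mE EI).
apply: le_lebm => t /= [It tS]; split => //=.
rewrite ltNge; apply/negP => S1.
move: tS; rewrite ger0_norm ?dsum_abs_ge0//.
apply/negP; rewrite -leNgt.
pose y k := 2 ^- k * `|f (t / q ^+ k)|.
have y0 k : 0 <= y k by rewrite mulr_ge0 ?invr_ge0 ?exprn_ge0.
have EE (k : 'I_(2 ^ n)) (m : 'I_n.+1) :
    \1_(E (k, m)) t = (lam / 2 ^+ m < y k)%R%:R :> R.
  rewrite indicE /y ltr_pdivlMl ?exprn_gt0//.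
  congr (_%:R); congr nat_of_bool; apply/idP/idP; first by rewrite inE => -[].
  by move=> h; rewrite inE; split.
have term0 j : 0 <= w j * \1_(E j) t by rewrite mulr_ge0// indicE.
(* A term above lam would activate the layer m = 0, whose weight is 2 > 1. *)
have ylam (k : 'I_(2 ^ n)) : y k <= lam.
  rewrite leNgt; apply/negP => lamy; move: S1; apply/negP; rewrite -ltNge.
  rewrite (bigD1 (k, ord0))//= EE /w expr0 !divr1 lamy mulr1.
  have : 0 <= \sum_(i | i != (k, ord0)) w i * \1_(E i) t by apply: sumr_ge0.
  by lra.
apply: (@le_trans _ _ (\sum_(k < 2 ^ n) (lam / 2 ^+ n +
    lam * \sum_(m < n.+1) w (k, m) * \1_(E (k, m)) t))).
  apply: ler_sum => k _.
  apply: (le_trans (dyadic_layers n (y0 k) (ylam k))).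
  by rewrite lerD2l ler_pM2l//; apply: ler_sum => m _; rewrite EE.
rewrite big_split/= sumr_const card_ord -mulr_sumr mulr2n mulrDl !mul1r.
apply: lerD.
  by rewrite -mulr_natr natrX divfK// expf_neq0.
rewrite ler_piMr ?(ltW lam0)//.
by apply: le_trans S1; rewrite (pair_bigA _ (fun k m => w (k, m) * \1_(E (k, m)) t))/= le_eqVlt; apply/orP; left; apply/eqP; apply: eq_bigr => -[].
Qed.

(** A quarter of d = 1/(r+p): [eps] and [vee] take one share each, and the remaining two are the two
    decaying factors in [big_set_le]. *)
Definition delta : R := (4 * (r + p))^-1.

Let rp0 : 0 < r + p. Proof. by rewrite addr_gt0. Qed.

Lemma delta_gt0 : 0 < delta. Proof. by rewrite invr_gt0 mulr_gt0. Qed.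

Lemma delta_lt1 : delta < 1.
Proof. by rewrite invf_lt1 ?mulr_gt0//; move: hp hr; lra. Qed.

(** For a fixed depth m, the sum over k is an l^p sum of quantities whose l^r sum is bounded by
    [lorentz_layers], so [sum_powR_le] applies. The n + 1 depths produce the logarithm. *)
Lemma distr_dsum f D lam n : lmeasurable I f -> 0 < D -> 0 < lam ->
  (lorentz_norm I p r%:E f <= D%:E)%E ->
  (distr I (dsum n (absf f)) (2 * lam)%R <=
   ((8 * D / lam) `^ p * (4 * n.+1%:R * (2 `^ (p - 4 * p * delta)) ^+ n))%:E)%E.
Proof.
move=> mf D0 lam0 fD.
apply: (le_trans (distr_dsum_layers n mf lam0)).
have lamm m : 0 < lam / 2 ^+ m by rewrite divr_gt0// exprn_gt0.
have fin k m : distr I f (2 ^+ k * (lam / 2 ^+ m)) \is a fin_num.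
  by apply: (distr_lorentz_fin hI hp hr (ltW D0) _ fD); rewrite mulr_gt0// exprn_gt0.
pose mu k m := fine (distr I f (2 ^+ k * (lam / 2 ^+ m))).
have mu0 k m : 0 <= mu k m by rewrite fine_ge0// lebm_ge0.
have muE k m : distr I f (2 ^+ k * (lam / 2 ^+ m)) = (mu k m)%:E by rewrite fineK.
rewrite -(pair_bigA _ (fun (k : 'I_(2 ^ n)) (m : 'I_n.+1) => (2 / 2 ^+ m)%R%:E *
     ((q ^+ k)%:E * distr I f (2 ^+ k * (lam / 2 ^+ m))%R))%E)/=.
rewrite exchange_big/=.
pose M := (8 * D / lam) `^ p.
pose kap := r / (r + p).
have D8 : 0 < 8 * D by rewrite mulr_gt0.
have row m : \sum_(k < 2 ^ n) q ^+ k * mu k m <= M * (2 ^+ m) `^ p * (2 * (2 `^ kap) ^+ n).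
  (* Dividing by 8 * D normalises the l^r sum to at most 1. *)
  pose x k := 2 ^+ k * (lam / 2 ^+ m) * mu k m `^ a / (8 * D).
  have x0 k : 0 <= x k by rewrite divr_ge0 ?(ltW D8)// !mulr_ge0 ?powR_ge0 ?exprn_ge0 ?(ltW lam0)// invr_ge0 exprn_ge0.
  have xr : \sum_(k < 2 ^ n) x k `^ r <= 1.
    have /(_ (2 ^ n)%N) := @lorentz_layers _ _ hI p r hp hr f D (lam / 2 ^+ m) _ (fun k => mu k m) (ltW D0) (lamm m) fD (mu0^~ m).
    have h k : ((mu k m)%:E <= distr I f (2 ^+ k * (lam / 2 ^+ m)))%E by rewrite muE.
    move=> /(_ h) {}h.
    rewrite -(ler_pM2l (powR_gt0 r D8)) mulr1 mulr_sumr; apply: le_trans h.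
    by apply: ler_sum => k _; rewrite -powRM ?(ltW D8)// /x mulrC divfK ?gt_eqF.
  have := sum_powR_le p0 r0 x0 xr.
  rewrite natrX exprn_powR// -/kap => xp.
  apply: le_trans (ler_wpM2l _ xp); last by rewrite mulr_ge0 ?powR_ge0.
  rewrite mulr_sumr; apply: ler_sum => k _.
  rewrite /M /q -exprn_powR// -!powRM ?x0 ?exprn_ge0 ?divr_ge0 ?mulr_ge0 ?invr_ge0 ?(ltW D0) ?(ltW lam0)//.
  have -> : mu k m = (mu k m `^ a) `^ p by rewrite -powRrM mulVf ?gt_eqF// powRr1.
  rewrite -powRM ?exprn_ge0 ?powR_ge0// le_eqVlt; apply/orP; left; apply/eqP.
  congr (_ `^ _); rewrite /x; set Z := mu k m `^ a; field.
  by rewrite !gt_eqF// exprn_gt0.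
apply: (@le_trans _ _ (\sum_(m < n.+1) (M * (4 * (2 `^ (p - 4 * p * delta)) ^+ n))%:E)%E); last first.
  rewrite sumEFin lee_fin sumr_const card_ord -/M -[_ *+ n.+1]mulr_natr.
  by rewrite le_eqVlt; apply/orP; left; apply/eqP; ring.
apply: lee_sum => m _.
under eq_bigr do rewrite muE -!EFinM.
rewrite sumEFin lee_fin -mulr_sumr.
apply: (le_trans (ler_wpM2l _ (row m))); first by rewrite divr_ge0 ?exprn_ge0.
(* Since p >= 1 the deepest layer m = n is the worst; with the saving of [row] it gives the exponent
   (p - 1) + kap = p - 4 * p * delta. *)
have mn : (2 ^+ m) `^ p / 2 ^+ m <= (2 ^+ n) `^ p / 2 ^+ n :> R.
  have E z : 0 < z -> z `^ p / z = z `^ (p - 1) :> R.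
    by move=> z0; rewrite powRB ?(gt_eqF z0) ?implybT// powRr1// ltW.
  rewrite !E ?exprn_gt0// ge0_ler_powR ?nnegrE ?subr_ge0 ?exprn_ge0//.
  by apply: ler_weXn2l; rewrite ?ler1n// -ltnS.
have -> : 2 / 2 ^+ m * (M * (2 ^+ m) `^ p * (2 * (2 `^ kap) ^+ n)) =
    M * (4 * ((2 ^+ m) `^ p / 2 ^+ m * (2 `^ kap) ^+ n)) by ring.
rewrite ler_wpM2l ?powR_ge0// ler_pM2l//.
apply: (@le_trans _ _ ((2 ^+ n) `^ p / 2 ^+ n * (2 `^ kap) ^+ n)).
  by rewrite ler_wpM2r// exprn_ge0// powR_ge0.
rewrite exprn_powR// -exprVn -!exprMn.
have -> // : 2 `^ p * 2^-1 * 2 `^ kap = 2 `^ (p - 4 * p * delta).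
rewrite -[2^-1](@powR_inv1 _ 2)// -!powRD ?pnatr_eq0 ?implybT//.
by congr (_ `^ _); rewrite /kap /delta; field; rewrite gt_eqF.
Qed.

(* Up to a logarithm [dsum n] has norm O(2^(n (1 - 4 delta))), so the weights [eps ^+ n]
   leave room for the thresholds [lam * vee ^+ n] of [big_set] below. *)
Definition eps : R := 2 `^ (delta - 1).
Definition vee : R := 2 `^ (- delta).

Lemma eps_gt0 : 0 < eps. Proof. exact: powR_gt0. Qed.
Lemma vee_gt0 : 0 < vee. Proof. exact: powR_gt0. Qed.

Let two_powR_lt1 x : x < 0 -> 2 `^ x < 1 :> R.
Proof.
move=> x0; rewrite /powR pnatr_eq0/= -[ltRHS]expR0 ltr_expR.
by rewrite nmulr_rlt0// ln_gt0// ltr1n.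
Qed.

Lemma eps_lt1 : eps < 1.
Proof. by apply: two_powR_lt1; rewrite subr_lt0 delta_lt1. Qed.

Lemma vee_lt1 : vee < 1.
Proof. by apply: two_powR_lt1; rewrite oppr_lt0 delta_gt0. Qed.

Definition big_set lam f : set R :=
  \bigcup_n (I `&` [set t | lam * vee ^+ n < eps ^+ n * dsum n (absf f) t]).

(** Piece n is a level set of [dsum n] at height lam * (vee / eps)^n, of measure at most a constant
    times (n + 1) * gam^(2n). One gam^n pays for n + 1, the other is summed over n. *)
Lemma big_set_le : exists2 K, 0 < K & forall f D lam, lmeasurable I f -> 0 < D -> 0 < lam ->
  (lorentz_norm I p r%:E f <= D%:E)%E -> (lebm (big_set lam f) <= (K * (D / lam) `^ p)%:E)%E.
Proof.
pose gam := 2 `^ (- (p * delta)) : R.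
have gam0 : 0 < gam by exact: powR_gt0.
have gam1 : gam < 1 by apply: two_powR_lt1; rewrite oppr_lt0 mulr_gt0// delta_gt0.
pose B := (1 - gam)^-1.
have B0 : 0 < B by rewrite invr_gt0 subr_gt0.
exists (16 `^ p * 4 * (B * B)); first by rewrite !mulr_gt0// powR_gt0.
move=> f D lam mf D0 lam0 fD.
have e0 := eps_gt0; have v0 := vee_gt0.
apply: le_trans (outer_measure_sigma_subadditive _ _) _ => /=.
pose Z := (16 * D / lam) `^ p * 4.
have Z0 : 0 <= Z by rewrite mulr_ge0 ?powR_ge0.
have step n : (lebm (I `&` [set t | (lam * vee ^+ n < eps ^+ n * dsum n (absf f) t)%R]) <=
    (Z * (B * gam ^+ n))%:E)%E.
  pose lam' := lam * (vee / eps) ^+ n / 2.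
  have lam'0 : 0 < lam' by rewrite !mulr_gt0// exprn_gt0// divr_gt0.
  apply: (@le_trans _ _ (distr I (dsum n (absf f)) (2 * lam'))).
    apply: le_lebm => t /= [It h]; split => //.
    rewrite ger0_norm ?dsum_abs_ge0// /lam' [ltLHS]mulrC divfK// expr_div_n mulrA ltr_pdivrMr ?exprn_gt0//.
    by rewrite [ltRHS]mulrC.
  apply: (le_trans (distr_dsum n mf D0 lam'0 fD)); rewrite lee_fin.
  have -> : 8 * D / lam' = 16 * D / lam * (eps / vee) ^+ n.
    have -> : (eps / vee) ^+ n = ((vee / eps) ^+ n)^-1 by rewrite -exprVn invf_div.
    rewrite /lam'; set X := (vee / eps) ^+ n.
    by field; rewrite !gt_eqF// exprn_gt0// divr_gt0.
  rewrite powRM ?exprn_ge0 ?divr_ge0 ?mulr_ge0 ?(ltW D0) ?(ltW lam0) ?(ltW e0) ?(ltW v0)//.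
  rewrite exprn_powR ?divr_ge0 ?(ltW e0) ?(ltW v0)//.
  have -> : (16 * D / lam) `^ p * ((eps / vee) `^ p) ^+ n * (4 * n.+1%:R * (2 `^ (p - 4 * p * delta)) ^+ n)
     = Z * (n.+1%:R * ((eps / vee) `^ p * 2 `^ (p - 4 * p * delta)) ^+ n).
    by rewrite /Z exprMn; ring.
  have -> : (eps / vee) `^ p * 2 `^ (p - 4 * p * delta) = gam * gam.
    rewrite /eps /vee /gam -[(2 `^ (- delta))^-1]powRN opprK -powRD ?pnatr_eq0 ?implybT//.
    rewrite -powRrM -!powRD ?pnatr_eq0 ?implybT//; congr (_ `^ _); ring.
  rewrite ler_wpM2l// exprMn mulrA ler_wpM2r ?exprn_ge0 ?(ltW gam0)//.
  by apply: natr_exprn_le => //; exact: ltW.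
apply: (@le_trans _ _ (\sum_(0 <= n <oo) (Z * (B * gam ^+ n))%:E)%E).
  by apply: lee_nneseries => [n _ _|n _]; [exact: lebm_ge0|exact: step].
have pos n : 0 <= Z * (B * gam ^+ n).
  exact: (mulr_ge0 Z0 (mulr_ge0 (ltW B0) (exprn_ge0 _ (ltW gam0)))).
apply: lime_le; first by apply: is_cvg_nneseries => n _ _; rewrite lee_fin.
apply: nearW => n; rewrite big_mkord sumEFin lee_fin -mulr_sumr -mulr_sumr.
have -> : 16 `^ p * 4 * (B * B) * (D / lam) `^ p = Z * (B * B).
  by rewrite /Z -[16 * D / lam]mulrA [in RHS]powRM ?divr_ge0 ?(ltW D0) ?(ltW lam0)//; ring.
rewrite ler_wpM2l// ler_wpM2l ?(ltW B0)//.
by apply: geometric_sum_le => //; exact: ltW.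
Qed.

End dilation_sums.

(** * The superposed operator and the bound on the Boyd index *)

Section dilation_operator.
Context {R : realType} (I : set R).
Hypothesis hI : I = `[0, 1]%classic \/ I = `[0, +oo[%classic.
Context (p r : R) (hp : 1 <= p) (hr : 1 <= r).
Local Notation a := (p^-1).
Local Notation q := (base p).
Local Notation eps := (eps p r).
Local Notation vee := (vee p r).
Local Notation dsum := (dsum p).
Local Notation Lp := (lorentz I p r%:E).
Local Notation Lweak := (lorentz I p +oo%E).
Implicit Types (f g : R -> R).

Let mI := I_measurable hI.
Let p0 : 0 < p. Proof. exact: lt_le_trans hp. Qed.
Let a0 : 0 < a. Proof. by rewrite invr_gt0. Qed.
Let e0 : 0 < eps. Proof. exact: eps_gt0. Qed.
Let e1 : eps < 1. Proof. exact: eps_lt1. Qed.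
Let v0 : 0 < vee. Proof. exact: vee_gt0. Qed.
Let v1 : vee < 1. Proof. exact: vee_lt1. Qed.

Definition psum m f (t : R) : R := \sum_(n < m) eps ^+ n * dsum n f t.

(** The operator T. Where the partial sums diverge the limit has a conventional value; by [bdd_sum]
    this happens only on a null set when f is in the domain. *)
Definition dop f (t : R) : R := limn (fun m => psum m f t).

(** Absolute convergence at t, expressed by boundedness since the partial sums for |f| are
    nondecreasing. *)
Definition bdd f t := exists B, forall m, psum m (absf f) t <= B.

Lemma dsumD c f g n t : dsum n (fun s => c * f s + g s) t = c * dsum n f t + dsum n g t.
Proof.
rewrite /dsum mulr_sumr -big_split/=; apply: eq_bigr => k _.
by rewrite mulrDr mulrCA.
Qed.

Lemma psumD c f g m t : psum m (fun s => c * f s + g s) t = c * psum m f t + psum m g t.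
Proof.
rewrite /psum mulr_sumr -big_split/=; apply: eq_bigr => k _.
by rewrite dsumD mulrDr mulrCA.
Qed.

Lemma dsum_norm_le n f t : `|dsum n f t| <= dsum n (absf f) t.
Proof.
apply: (le_trans (ler_norm_sum _ _ _)); apply: ler_sum => k _.
by rewrite normrM ger0_norm ?invr_ge0 ?exprn_ge0.
Qed.

Lemma psum_norm_le m f t : `|psum m f t| <= psum m (absf f) t.
Proof.
apply: (le_trans (ler_norm_sum _ _ _)); apply: ler_sum => k _.
rewrite normrM ger0_norm ?exprn_ge0 ?(ltW e0)// ler_wpM2l ?exprn_ge0 ?(ltW e0)//.
exact: dsum_norm_le.
Qed.

Lemma psum_mono m f g t : (forall k, f (t / q ^+ k) <= g (t / q ^+ k)) ->
  psum m f t <= psum m g t.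
Proof.
move=> fg; apply: ler_sum => n _; rewrite ler_wpM2l ?exprn_ge0 ?(ltW e0)//.
by apply: ler_sum => k _; rewrite ler_wpM2l ?invr_ge0 ?exprn_ge0.
Qed.

Lemma psum_eq m f g t : (forall k, f (t / q ^+ k) = g (t / q ^+ k)) ->
  psum m f t = psum m g t.
Proof. by move=> fg; apply/eqP; rewrite eq_le !psum_mono// => k; rewrite fg. Qed.

Lemma psum_cst_le m c t : 0 <= c -> psum m (fun=> c) t <= 2 / (1 - eps) * c.
Proof.
move=> c0; apply: (@le_trans _ _ (\sum_(n < m) eps ^+ n * (2 * c))).
  apply: ler_sum => n _; rewrite ler_wpM2l ?exprn_ge0 ?(ltW e0)//.
  rewrite /dsum -mulr_suml ler_wpM2r//.
  under eq_bigr do rewrite -exprVn.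
  have h1 : 2^-1 < 1 :> R by lra.
  have h2 : 0 <= 2^-1 :> R by lra.
  by apply: (le_trans (geometric_sum_le (2 ^ n) h2 h1)); rewrite -[leRHS]invrK lef_pV2 ?posrE; lra.
rewrite -mulr_suml [2 / _]mulrC -mulrA ler_wpM2r ?mulr_ge0//.
by apply: geometric_sum_le => //; exact: ltW.
Qed.

Lemma psum_cvg f t B : (forall m, psum m (absf f) t <= B) ->
  cvgn (fun m => psum m f t) /\ `|dop f t| <= B.
Proof.
move=> fB.
have cf : cvgn (fun m => psum m f t).
  pose u n := eps ^+ n * dsum n f t.
  have E : (fun m => psum m f t) = series u.
    by apply/funext => m; rewrite /psum /series/= big_mkord.
  rewrite E; apply: normed_cvg.
  apply: nondecreasing_is_cvgn.
    by apply: nondecreasing_series => n _ _; exact: normr_ge0.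
  exists B => _ [m _ <-]; apply: le_trans (fB m).
  rewrite -[leLHS]/(\sum_(0 <= n < m) `|u n|) big_mkord; apply: ler_sum => n _.
  rewrite /u normrM ger0_norm ?exprn_ge0 ?(ltW e0)// ler_wpM2l ?exprn_ge0 ?(ltW e0)//.
  exact: dsum_norm_le.
split => //.
have cn : cvgn (fun m => `|psum m f t|) by apply: is_cvg_norm.
rewrite /dop -lim_norm//; apply: limr_le => //.
by apply: nearW => m; apply: (le_trans (psum_norm_le m f t)).
Qed.

Lemma bdd_cvg f t : bdd f t -> cvgn (fun m => psum m f t).
Proof. by move=> [B /psum_cvg[]]. Qed.

Lemma dop_linear c f g t : bdd f t -> bdd g t ->
  dop (fun s => c * f s + g s) t = c * dop f t + dop g t.
Proof.
move=> /bdd_cvg cf /bdd_cvg cg; apply: cvg_lim => //.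
under eq_fun do rewrite psumD.
by apply: cvgD cg; apply: cvgM cf; exact: cvg_cst.
Qed.

Lemma bdd_dominated f g h t : (forall k, `|f (t / q ^+ k)| <= `|g (t / q ^+ k)| + `|h (t / q ^+ k)|) ->
  bdd g t -> bdd h t -> bdd f t.
Proof.
move=> fgh [Bg hg] [Bh hh]; exists (Bg + Bh) => m.
apply: (@le_trans _ _ (psum m (fun s => 1 * absf g s + absf h s) t)).
  by apply: psum_mono => k; rewrite mul1r; exact: fgh.
by rewrite psumD mul1r lerD.
Qed.

(** T f at t depends only on the values of f along the countable orbit t / q^k, and scaling
    preserves null sets. *)
Lemma ae_on_dil (P : R -> Prop) : ae_on I P -> ae_on I (fun t => forall k, P (t / q ^+ k)).
Proof.
by move=> IP; apply: ae_on_forall => k; apply: (ae_on_div hI) => //; exact: base_ge1.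
Qed.

Lemma dop_ae_eq f g : ae_on I (fun t => f t = g t) -> ae_on I (fun t => dop f t = dop g t).
Proof.
move=> /ae_on_dil fg; apply: ae_on_sub fg _ => t _ fg.
by congr (lim (_ @ \oo)); apply/funext => m; exact: psum_eq.
Qed.

Lemma bdd_ae_eq f g : ae_on I (fun t => f t = g t) -> ae_on I (bdd f) -> ae_on I (bdd g).
Proof.
move=> /ae_on_dil fg bf; apply: ae_on_sub2 fg bf _ => t _ fg [B fB]; exists B => m.
by apply: le_trans (fB m); apply: psum_mono => k; rewrite /absf fg.
Qed.

Lemma bdd_Linfty f c : 0 <= c -> ae_on I (fun t => `|f t| <= c) ->
  ae_on I (bdd f) /\ ae_on I (fun t => `|dop f t| <= 2 / (1 - eps) * c).
Proof.
move=> c0 /ae_on_dil fc.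
have h : ae_on I (fun t => forall m, psum m (absf f) t <= 2 / (1 - eps) * c).
  apply: ae_on_sub fc _ => t _ fc m.
  by apply: le_trans (psum_cst_le m t c0); apply: psum_mono.
by split; apply: ae_on_sub h _ => t _ h; [exists (2 / (1 - eps) * c)|exact: (psum_cvg h).2].
Qed.

(** The upper limit of the partial sums is measurable in the extended reals and agrees with T f
    almost everywhere; completeness of the measure does the rest. *)
Lemma lmeasurable_dop f : lmeasurable I f -> ae_on I (bdd f) -> lmeasurable I (dop f).
Proof.
move=> mf bf.
have mps m : lmeasurable I (psum m f).
  apply: (@lmeasurable_sum _ _ _ (fun n t => eps ^+ n * dsum n f t)) => n.
  by apply: lmeasurableZ; exact: (lmeasurable_dsum hI hp).
have mlim : measurable_fun (I : set (leb R))
    (fun t : leb R => limn_esup (fun m => (psum m f t)%:E)).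
  by apply: measurable_fun_limn_esup => m; apply/measurable_EFinP; exact: mps.
have /(ae_measurable_fun completed_lebesgue_measure_is_complete) h :
  ae_eq (@lebm R) (I : set (leb R)) (fun t : leb R => limn_esup (fun m => (psum m f t)%:E))
    (EFin \o dop f : leb R -> \bar R).
  suff: ae_on I (fun t => limn_esup (fun m => (psum m f t)%:E) = (dop f t)%:E) by [].
  apply: ae_on_sub bf _ => t _ /bdd_cvg cf.
  have ce : (psum m f t)%:E @[m --> \oo] --> (dop f t)%:E.
    by apply: cvg_EFin; [exact: nearW|exact: cf].
  rewrite is_cvg_limn_esupE; first exact: cvg_lim.
  by apply/cvg_ex; exists (dop f t)%:E.
by apply/measurable_EFinP; exact: h.
Qed.

Lemma good_point lam f t : 0 < lam -> I t -> ~ big_set I p r lam f t ->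
  forall m, psum m (absf f) t <= lam * (1 - vee)^-1.
Proof.
move=> lam0 It nb m.
apply: (@le_trans _ _ (\sum_(n < m) lam * vee ^+ n)).
  apply: ler_sum => n _; rewrite leNgt; apply/negP => h; apply: nb.
  by exists n.
rewrite -mulr_sumr ler_wpM2l ?(ltW lam0)//.
by apply: geometric_sum_le => //; exact: ltW.
Qed.

Let hr' : r%:E = +oo%E \/ exists2 r' : R, 1 <= r' & r%:E = r'%:E.
Proof. by right; exists r. Qed.

Lemma bdd_lorentz f : Lp f -> ae_on I (bdd f).
Proof.
move=> Lf; have mf := Lf.1.
have [K K0 hK] := big_set_le hI hp hr.
pose D := qnorm Lp f + 1.
have D0 : 0 < D by rewrite ltr_wpDl// (lorentz_qnorm_ge0 hI hp).
have fD : (lorentz_norm I p r%:E f <= D%:E)%E.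
  by rewrite -(lorentz_fin hI hp Lf) lee_fin lerDl.
apply/ae_onE; apply/lebm_le0; apply/lee_addgt0Pr => e ep0.
rewrite add0e.
(* Chosen so that K * (D / lam)^p = e. *)
pose lam := D * (K / e) `^ a.
have Ke : 0 < K / e by rewrite divr_gt0.
have lam0 : 0 < lam by rewrite mulr_gt0// powR_gt0.
apply: (@le_trans _ _ (lebm (big_set I p r lam f))).
  apply: le_lebm => t /= [It nb]; apply: contrapT => nU; apply: nb.
  by exists (lam * (1 - vee)^-1); exact: good_point.
apply: (le_trans (hK f D lam mf D0 lam0 fD)); rewrite lee_fin.
have -> : D / lam = ((K / e) `^ a)^-1.
  by rewrite /lam invfM mulrA mulfV ?mul1r// gt_eqF.
rewrite -powRN -powRrM mulNr mulVf ?gt_eqF// powRN powRr1 ?(ltW Ke)//.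
by rewrite invf_div mulrCA mulfV ?mulr1// gt_eqF.
Qed.

Lemma dop_lorentz : exists C, forall f, Lp f -> Lweak (dop f) /\
  qnorm Lweak (dop f) <= C * qnorm Lp f.
Proof.
have [K K0 hK] := big_set_le hI hp hr.
pose V := (1 - vee)^-1.
have V0 : 0 < V by rewrite invr_gt0 subr_gt0.
pose C := V * K `^ a.
have C0 : 0 < C by rewrite mulr_gt0// powR_gt0.
exists C => f Lf; have mf := Lf.1.
have bf := bdd_lorentz Lf.
have mTf := lmeasurable_dop mf bf.
(* The norm may be 0 while [big_set_le] takes a positive bound, so D stays strictly above the norm;
   the final limit argument removes the gap. *)
have key D : qnorm Lp f < D -> (lorentz_norm I p +oo%E (dop f) <= (C * D)%:E)%E.
  move=> fD.
  have D0 : 0 < D by apply: le_lt_trans fD; exact: (lorentz_qnorm_ge0 hI hp).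
  have fD' : (lorentz_norm I p r%:E f <= D%:E)%E.
    by rewrite -(lorentz_fin hI hp Lf) lee_fin ltW.
  apply: ge_ereal_sup => _ [t It <-].
  have [->|tn0] := eqVneq t 0.
    rewrite powR0 ?gt_eqF// mul0e lee_fin.
    exact: (mulr_ge0 (ltW C0) (ltW D0)).
  have t0 : 0 < t by rewrite lt_neqAle eq_sym tn0 (I_ge0 hI It).
  pose lam := D * (K / t) `^ a.
  have Kt : 0 < K / t by rewrite divr_gt0.
  have lam0 : 0 < lam by rewrite mulr_gt0// powR_gt0.
  have rt : (rearrangement I (dop f) t <= (lam * V)%:E)%E.
    apply: rearr_le; first by rewrite mulr_ge0 ?(ltW lam0) ?(ltW V0).
    apply: (@le_trans _ _ (lebm (big_set I p r lam f))).
      apply: le_lebm => s /= [Is]; rewrite ltNge => /negP nd.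
      apply: contrapT => nU; apply: nd.
      exact: (psum_cvg (good_point lam0 Is nU)).2.
    apply: (le_trans (hK f D lam mf D0 lam0 fD')); rewrite lee_fin.
    have -> : D / lam = ((K / t) `^ a)^-1.
      by rewrite /lam invfM mulrA mulfV ?mul1r// gt_eqF.
    rewrite -powRN -powRrM mulNr mulVf ?gt_eqF// powRN powRr1 ?(ltW Kt)//.
    by rewrite invf_div mulrCA mulfV ?mulr1// gt_eqF.
  apply: (@le_trans _ _ ((t `^ a)%:E * (lam * V)%:E)%E).
    by rewrite lee_wpmul2l// lee_fin powR_ge0.
  rewrite -EFinM lee_fin le_eqVlt; apply/orP; left; apply/eqP.
  have KE : K `^ a = t `^ a * (K / t) `^ a.
    rewrite -powRM ?(ltW t0) ?(ltW Kt)//; congr (_ `^ _).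
    by rewrite mulrCA mulfV ?mulr1// gt_eqF.
  by rewrite /C /lam KE; ring.
have fin : (lorentz_norm I p +oo%E (dop f) < +oo)%E.
  by apply: le_lt_trans (key (qnorm Lp f + 1) _) _; rewrite ?ltry// ltrDl.
split; first by split.
apply/ler_addgt0Pr => e ep0.
have h : qnorm Lp f < qnorm Lp f + e / C by rewrite ltrDl divr_gt0.
have := key _ h; rewrite mulrDr [C * (e / C)]mulrC divfK ?gt_eqF// => le.
rewrite -lee_fin; apply: le_trans le.
rewrite /qnorm/= fineK// ge0_fin_numE//; exact: (lorentz_norm_ge0 hI hp +oo%E).
Qed.

Lemma dop_Linfty : exists C, forall f, Linfty I f -> Linfty I (dop f) /\
  qnorm (Linfty I) (dop f) <= C * qnorm (Linfty I) f.
Proof.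
exists (2 / (1 - eps)) => f Lf.
have [bf df] := bdd_Linfty (Linfty_qnorm_ge0 I f) (LinftyP Lf).
apply: Linfty_bounded => //; first by apply: lmeasurable_dop => //; case: Lf.
by rewrite mulr_ge0 ?Linfty_qnorm_ge0// divr_ge0// subr_ge0 ltW.
Qed.

Lemma bdd_sum f : sum_space I Lp (Linfty I) f -> ae_on I (bdd f).
Proof.
move=> [mf [u [v [Lu Lv fuv]]]].
have bu := bdd_lorentz Lu.
have [bv _] := bdd_Linfty (Linfty_qnorm_ge0 I v) (LinftyP Lv).
apply: (@bdd_ae_eq (fun t => u t + v t)); first by apply: ae_on_sub fuv _.
apply: ae_on_sub2 bu bv _ => t _; apply: bdd_dominated => k.
exact: ler_normD.
Qed.

Lemma dop_operator : linear_operator I (sum_space I Lp (Linfty I))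
  (sum_space I Lweak (Linfty I)) dop.
Proof.
split.
- move=> f Sf; have bf := bdd_sum Sf; case: Sf => mf [u [v [Lu Lv fuv]]].
  split; first exact: lmeasurable_dop.
  have [C1 h1] := dop_lorentz; have [C2 h2] := dop_Linfty.
  exists (dop u), (dop v); split; [exact: (h1 _ Lu).1|exact: (h2 _ Lv).1|].
  have bu := bdd_lorentz Lu.
  have [bv _] := bdd_Linfty (Linfty_qnorm_ge0 I v) (LinftyP Lv).
  have E : ae_on I (fun t => f t = 1 * u t + v t).
    by apply: ae_on_sub fuv _ => t _ ->; rewrite mul1r.
  apply: ae_on_sub2 (dop_ae_eq E) (ae_on_sub2 bu bv (fun t _ => @dop_linear 1 u v t)) _.
  by move=> t _ -> ->; rewrite mul1r.
- by move=> f g _ _; exact: dop_ae_eq.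
move=> c f g /bdd_sum bf /bdd_sum bg.
by apply: ae_on_sub2 bf bg _ => t _; exact: dop_linear.
Qed.

Context (Y : fspace R) (hY : banach_ri I Y).
Hypothesis hLI : LI I Lp Lweak Y.

Local Notation "'N'" := (qnorm Y).

(** For nonnegative f the series for T f dominates its n-th term eps^n * [dsum n f], so boundedness
    of T on Y costs only the factor eps^(-n) = 2^(n (1 - delta)). *)
Lemma dsum_bounded : exists2 M, 0 <= M & forall n f, Y f -> (forall t, 0 <= f t) ->
  Y (dsum n f) /\ N (dsum n f) <= M * (eps ^+ n)^-1 * N f.
Proof.
have [M hM] := LI_interp hLI dop_operator dop_lorentz dop_Linfty.
exists `|M| => // n f Yf f0.
have [YT NT] := hM f Yf.
have en0 : 0 < (eps ^+ n)^-1 by rewrite invr_gt0 exprn_gt0.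
have YT' := Y_scale hY (eps ^+ n)^-1 YT.
have bf := bdd_sum ((LI_up0 hLI).1 _ Yf).
have [|Yd Nd] := Y_lattice hY YT' (lmeasurable_dsum hI hp n (Y_measurable hY Yf)).
  apply: ae_on_sub bf _ => t _ /bdd_cvg cf.
  rewrite ger0_norm ?dsum_ge0//; apply: le_trans (ler_norm _).
  rewrite ler_pdivlMl ?exprn_gt0//.
  apply: limr_ge => //; near=> m.
  have nm : (n < m)%N by near: m; exact: nbhs_infty_gt.
  rewrite /psum (bigD1 (Ordinal nm))//= lerDl; apply: sumr_ge0 => k _.
  by rewrite mulr_ge0 ?exprn_ge0 ?(ltW e0)// dsum_ge0.
split => //; apply: (le_trans Nd).
rewrite (Y_normZ hY)// ger0_norm ?(ltW en0)// [`|M| * _]mulrC -mulrA ler_pM2l//.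
apply: (le_trans NT); rewrite ler_wpM2r ?(Y_norm_ge0 hY)//; exact: ler_norm.
Unshelve. all: by end_near. Qed.

(** For m < 2^n, the coefficient of A^m in the power j + 1 of the sum is binomial(m + j, j) >= (m +
    1)^j / j!. The induction convolves with one more factor, dropping the nonnegative terms of index
    above m. *)
Lemma iter_dsum_ge n f j m t : (forall t, 0 <= f t) -> (m < 2 ^ n)%N ->
  m.+1%:R ^+ j / j`!%:R * (2 ^- m * f (t / q ^+ m)) <= iter j.+1 (dsum n) f t.
Proof.
move=> f0; elim: j m t => [|j IH] m t mn.
  rewrite expr0 fact0 divr1 mul1r /= /dsum (bigD1 (Ordinal mn))//= lerDl.
  by apply: sumr_ge0 => k _; rewrite mulr_ge0 ?invr_ge0 ?exprn_ge0.
have it0 i s : 0 <= iter i (dsum n) f s.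
  elim: i s => [|i IHi] s //=; exact: dsum_ge0.
rewrite -[leRHS]/(\sum_(k < 2 ^ n) 2 ^- k * iter j.+1 (dsum n) f (t / q ^+ k)).
have -> : \sum_(k < 2 ^ n) 2 ^- k * iter j.+1 (dsum n) f (t / q ^+ k) =
   \sum_(0 <= k < 2 ^ n) 2 ^- k * iter j.+1 (dsum n) f (t / q ^+ k) by rewrite big_mkord.
rewrite (@big_cat_nat _ _ _ m.+1)//=.
apply: (@le_trans _ _ (\sum_(0 <= k < m.+1) 2 ^- k * iter j.+1 (dsum n) f (t / q ^+ k))); last first.
  by rewrite lerDl; apply: sumr_ge0 => k _; rewrite mulr_ge0 ?invr_ge0 ?exprn_ge0//; exact: (it0 j.+1).
rewrite big_mkord.
apply: (@le_trans _ _ (\sum_(i < m.+1) (m - i).+1%:R ^+ j / j`!%:R * (2 ^- m * f (t / q ^+ m)))); last first.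
  apply: ler_sum => i _; have im : (i <= m)%N by rewrite -ltnS.
  have mi : (m - i < 2 ^ n)%N by rewrite (leq_ltn_trans (leq_subr _ _)).
  apply: le_trans (ler_wpM2l _ (IH (m - i)%N (t / q ^+ i) mi)); last first.
    by rewrite invr_ge0 exprn_ge0.
  have -> : t / q ^+ i / q ^+ (m - i) = t / q ^+ m.
    by rewrite -mulrA -invfM -exprD subnKC.
  have -> : 2 ^- m = 2 ^- i * 2 ^- (m - i) :> R by rewrite -invfM -exprD subnKC.
  by rewrite le_eqVlt; apply/orP; left; apply/eqP; ring.
rewrite -mulr_suml ler_wpM2r ?mulr_ge0 ?invr_ge0 ?exprn_ge0//.
rewrite -mulr_suml factS natrM invfM mulrA ler_wpM2r ?invr_ge0//.
by rewrite ler_pdivrMr ?ltr0n// mulrC sum_exprn_ge.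
Qed.

Lemma boyd_index_lt_of_LI : upper_boyd_index I Y < a.
Proof.
have [M M0 hM] := dsum_bounded.
have del0 : 0 < delta p r by exact: delta_gt0.
(* The number of iterations is N = j + 1. Asking for delta * N >= 2, rather than just above 1, gains
   a full factor 2^(-n). *)
pose j := Num.bound (2 / delta p r).
have jd : 2 <= delta p r * j.+1%:R.
  have h : 0 <= 2 / delta p r by rewrite divr_ge0// ltW.
  have := archi_boundP h; rewrite -/j ltr_pdivrMr// mulrC -natr1; nra.
have iterb n : forall i f, Y f -> (forall t, 0 <= f t) -> [/\ Y (iter i (dsum n) f),
    (forall t, 0 <= iter i (dsum n) f t) &
    N (iter i (dsum n) f) <= (M * (eps ^+ n)^-1) ^+ i * N f].
  elim=> [|i IH] f Yf f0; first by split => //; rewrite expr0 mul1r.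
  have [Yi i0 Ni] := IH f Yf f0; have [Yd Nd] := hM n _ Yi i0.
  split; [exact: Yd|by move=> t; exact: dsum_ge0|].
  apply: (le_trans Nd); rewrite exprS -[leRHS]mulrA ler_wpM2l//.
  by rewrite mulr_ge0// invr_ge0 exprn_ge0// ltW.
pose W := j`!%:R * M ^+ j.+1.
have W0 : 0 <= W by rewrite mulr_ge0// exprn_ge0.
(* Makes W / 2^n at most 1/2; the summand 2 also forces n > 0, hence m > 0 below. *)
have [n Wn] := @exprn_unbounded R 2 (2 * W + 2) (ltr1n _ _).
(* The last index covered by [iter_dsum_ge], where (m + 1)^j equals L^j. *)
pose L := (2 ^ n)%N; pose m := L.-1.
have n0 : (0 < n)%N by case: n Wn @L @m => //; rewrite expr0; lra.
have L1 : (1 < L)%N by rewrite /L -[1%N](expn0 2) ltn_exp2l.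
have mL : m.+1 = L by rewrite /m prednK// ltnW.
have m0 : (0 < m)%N by rewrite -ltnS mL.
have mlt : (m < 2 ^ n)%N by rewrite -/L -mL.
have qm1 : 1 < q ^+ m.
  rewrite exprn_egt1 -?lt0n// /base -[ltLHS](powRr0 2).
  by rewrite /powR pnatr_eq0/= ltr_expR mul0r mulr_gt0// ln_gt0// ltr1n.
have bound f : Y f -> (forall t, 0 <= f t) -> N (dil (q ^+ m) f) <= 2 ^+ m / 2 * N f.
  move=> Yf f0.
  have [Yi i0 Ni] := iterb n j.+1 f Yf f0.
  pose c := L%:R ^+ j / j`!%:R / 2 ^+ m : R.
  have LR : 0 < L%:R :> R by rewrite ltr0n ltnW.
  have fj : 0 < j`!%:R :> R by rewrite ltr0n fact_gt0.
  have c0 : 0 < c by rewrite !divr_gt0// ?exprn_gt0.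
  have Yd : Y (dil (q ^+ m) f) by have [] := Y_dilation hI hY (ltW qm1) Yf.
  have [|_ Nd] := Y_lattice hY Yi (Y_measurable hY (Y_scale hY c Yd)).
    apply: ae_on_all => t _; rewrite !ger0_norm//; last by rewrite mulr_ge0 ?(ltW c0)// /dil.
    by have := @iter_dsum_ge n f j m t f0 mlt; rewrite mL /c /dil mulrA.
  move: Nd; rewrite (Y_normZ hY)// ger0_norm ?(ltW c0)// => Nd.
  have {}Nd := le_trans Nd Ni.
  rewrite -ler_pdivlMl// in Nd; apply: (le_trans Nd).
  rewrite mulrA ler_wpM2r ?(Y_norm_ge0 hY)//.
  have L2 : L%:R = 2 ^+ n :> R by rewrite /L natrX.
  have E : (M * (eps ^+ n)^-1) ^+ j.+1 = M ^+ j.+1 * (2 `^ ((1 - delta p r) * j.+1%:R)) ^+ n.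
    rewrite exprMn; congr (_ * _).
    rewrite -exprVn -exprM mulnC exprM; congr (_ ^+ _).
    rewrite /eps powRrM powR_mulrn ?powR_ge0//; congr (_ ^+ _).
    by rewrite -powRN opprB.
  (* As delta * (j + 1) >= 2, the exponent is at most j - 1, so the norm of the iterate grows slower
     than the coefficient L^j by a factor 2^n. *)
  have F : 2 `^ ((1 - delta p r) * j.+1%:R) <= 2 ^+ j / 2 :> R.
    apply: (@le_trans _ _ (2 `^ (j%:R - 1))).
      rewrite ler_powR ?ler1n//; move: jd; rewrite -natr1; lra.
    by rewrite powRB ?pnatr_eq0 ?implybT// powR_mulrn// powRr1.
  have {}E : (M * (eps ^+ n)^-1) ^+ j.+1 <= M ^+ j.+1 * (2 ^+ j / 2) ^+ n.
    rewrite E ler_wpM2l ?exprn_ge0//; apply: lerXn2r; rewrite ?nnegrE ?powR_ge0//.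
  have ci : 0 <= c^-1 by rewrite invr_ge0 ltW.
  apply: (le_trans (ler_wpM2l ci E)).
  rewrite /c L2 expr_div_n -exprM [(n * j)%N]mulnC exprM.
  set X := (2 ^+ j) ^+ n.
  have Xe : (2 ^+ n) ^+ j = X by rewrite /X -!exprM mulnC.
  have X0 : 0 < X by rewrite !exprn_gt0.
  have P0 : 0 < 2 ^+ m :> R by rewrite exprn_gt0.
  have N0 : 0 < 2 ^+ n :> R by rewrite exprn_gt0.
  have -> : (X / j`!%:R / 2 ^+ m)^-1 * (M ^+ j.+1 * (X / 2 ^+ n)) = 2 ^+ m * (W / 2 ^+ n).
    by rewrite /W; field; rewrite !gt_eqF.
  by rewrite ler_pM2l// ler_pdivrMr//; lra.
apply: (@upper_boyd_index_lt _ _ hI _ hY _ (q ^+ m) qm1).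
have P0 : 0 < 2 ^+ m :> R by rewrite exprn_gt0.
apply: (@le_lt_trans _ _ (2 ^+ m / 2)).
  apply: (opnorm_le hI hY (ltW qm1)); first by rewrite divr_ge0// ltW.
  (* The comparison of coefficients needs nonnegative functions; |f| has the same norm as f and
     commutes with dilation. *)
  move=> f Yf; have [Ya Na] := Y_abs hY Yf.
  have Yd : Y (dil (q ^+ m) f) by have [] := Y_dilation hI hY (ltW qm1) Yf.
  have [_ <-] := Y_abs hY Yd; rewrite -Na.
  exact: (bound (absf f) Ya (fun t => normr_ge0 (f t))).
rewrite exprn_powR ?powR_ge0// /base -powRrM mulfV ?gt_eqF// powRr1//.
lra.
Qed.

End dilation_operator.

Unset Implicit Arguments.

Theorem proposition7 (R : realType) (I : set R)
    (hI : I = `[0, 1]%classic \/ I = `[0, +oo[%classic)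
    (p : R) (hp : 1 <= p) (Y : fspace R) (hY : banach_ri I Y) :
  (LI I (lorentz I p 1%:E) (lorentz I p +oo%E) Y
     <-> exists r : R, 1 < r /\
           LI I (lorentz I p r%:E) (lorentz I p +oo%E) Y) /\
  (LI I (lorentz I p 1%:E) (lorentz I p +oo%E) Y
     <-> upper_boyd_index I Y < p^-1).
Proof.
have LI_boyd r : 1 <= r ->
    LI I (lorentz I p r%:E) (lorentz I p +oo%E) Y <-> upper_boyd_index I Y < p^-1.
  move=> r1; split; first exact: boyd_index_lt_of_LI.
  exact: LI_of_boyd_index_lt.
split; last exact: LI_boyd.
split=> [/(LI_boyd _ (lexx _)) Yp|[r [r1 /(LI_boyd _ (ltW r1)) Yp]]].
  by exists 2; split; [rewrite ltr1n|apply/LI_boyd => //; rewrite ler1n].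
exact/LI_boyd.
Qed.
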